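(* Consider an ordered field $R$ and its extension $C=R[i]$ where $i^2=-1$. Let $\Omega$ be the set of piecewise polynomial loops $\gamma\colon[0,1]\to C^*=C\smallsetminus\{0\}$. Define the algebraic winding number $w\colon\Omega\to\mathbb{Z}$ by the following algebraic property: (W0) Computation: $w(\gamma)$ equals half the Cauchy index of $\frac{\operatorname{re}\gamma}{\operatorname{im}\gamma}$, i.e. $w(\gamma)=\frac12\sum_{k=1}^n\operatorname{Ind}_{t_{k-1}}^{t_k}\bigl(\frac{\operatorname{re}P_k}{\operatorname{im}P_k}\bigr)$ if $\gamma$ is given by polynomials $P_k\in C[X]$ on the intervals $[t_{k-1},t_k]$ of a subdivision $0=t_0<t_1<\dots<t_n=1$, and it can thus be calculated by Sturm's algorithm via iterated euclidean division. If $R$ is real closed, then $w$ enjoys the following geometric properties: (W1) Normalization: Let $\Gamma\subset C$ be a rectangle of the form $\Gamma=[x_0,x_1]\times[y_0,y_1]$. If $\gamma$ parametrizes the boundary $\partial\Gamma\subset C^*$, positively oriented, then $w(\gamma)=1$ if $0\in\operatorname{Int}\Gamma$, and $w(\gamma)=0$ if $0\in C\smallsetminus\Gamma$. (W2) Multiplicativity: For all $\gamma_1,\gamma_2\in\Omega$ we have $w(\gamma_1\cdot\gamma_2)=w(\gamma_1)+w(\gamma_2)$, where $\gamma_1\cdot\gamma_2$ is the pointwise product. (W3) Homotopy invariance: For all $\gamma_0,\gamma_1\in\Omega$ we have $w(\gamma_0)=w(\gamma_1)$ whenever $\gamma_0$ and $\gamma_1$ are homotopic in $C^*$. Conversely,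 if over some ordered field $R$ there exists a map $w\colon\Omega\to\mathbb{Z}$ satisfying properties (W1), (W2), (W3), then $R$ is real closed and $w$ can be calculated as in (W0).
   Context: Real closed: an ordered field $R$ is real closed if whenever $P\in R[X]$ and $a<b$ in $R$ satisfy $P(a)P(b)<0$, there is $x\in R$ with $a<x<b$ and $P(x)=0$. Intervals are taken in $R$. $C=R[i]$ is identified with $R^2$ via $(x,y)\mapsto x+iy$; for $P\in C[X]$, $\operatorname{re}P,\operatorname{im}P\in R[X]$ are the polynomials with $P=\operatorname{re}P+i\operatorname{im}P$. Cauchy index: let $f\in R(X)$, $f\ne0$, $a\in R$, and write $f=(X-a)^m g$ with $m\in\mathbb{Z}$ and $g$ having neither zero nor pole at $a$. If $m\ge0$ put $\operatorname{Ind}_a^{+}(f)=\operatorname{Ind}_a^{-}(f)=0$. If $m<0$ put $\operatorname{Ind}_a^{+}(f)=\frac12\operatorname{sign}g(a)$ and $\operatorname{Ind}_a^{-}(f)=\frac12(-1)^m\operatorname{sign}g(a)$. Let $\operatorname{Ind}_x(f)=\operatorname{Ind}_x^+(f)-\operatorname{Ind}_x^-(f)$. For $a<b$, $\operatorname{Ind}_a^b(f)=\operatorname{Ind}_a^+(f)+\sum_{a<x<b}\operatorname{Ind}_x(f)-\operatorname{Ind}_b^-(f)$. By convention $\operatorname{Ind}_a^b(\frac{U}{V})=0$ if $U=0$ or $V=0$. Sturm's algorithm: for nonzero $U,V\in R[X]$, let $P_0=V$, $P_1=U$, and by iterated euclidean division $P_{k-1}=Q_kP_k-P_{k+1}$ with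 $\deg P_{k+1}<\deg P_k$, until $P_{m+1}=0$, $P_m\neq0$. Put $S_k=P_k/P_m$ for $0\le k\le m$. The algorithm returns for $\frac UV$ on $[a,b]$ the number $V_a(S_0,\dots,S_m)-V_b(S_0,\dots,S_m)$, where $V_a(S_0,\dots,S_m)=\sum_{k=1}^m\frac12|\operatorname{sign}S_{k-1}(a)-\operatorname{sign}S_k(a)|$ and $\operatorname{sign}(0)=0$. If $U=0$ or $V=0$ it returns $0$. Piecewise polynomial loop: a map $\gamma\colon[0,1]\to C$ for which there are a subdivision $0=t_0<\dots<t_n=1$ in $R$ and $P_1,\dots,P_n\in C[X]$ with $\gamma(t)=P_k(t)$ for $t\in[t_{k-1},t_k]$ (so $P_k(t_k)=P_{k+1}(t_k)$), and with $\gamma(0)=\gamma(1)$. The value in (W0) does not depend on the chosen subdivision. Rectangle: $\Gamma=[x_0,x_1]\times[y_0,y_1]$ with $x_0<x_1$, $y_0<y_1$ in $R$; its interior $\operatorname{Int}\Gamma$ is the product of the open intervals; its positively oriented boundary parametrization $\gamma\colon[0,1]\to C$ interpolates linearly between $\gamma(0)=(x_0,y_0)$, $\gamma(\frac14)=(x_1,y_0)$, $\gamma(\frac12)=(x_1,y_1)$, $\gamma(\frac34)=(x_0,y_1)$, $\gamma(1)=(x_0,y_0)$. Homotopy in $C^*$ between $\gamma_0,\gamma_1\in\Omega$: a map $H\colon[0,1]\times[0,1]\to C^*$ with $H(0,t)=\gamma_0(t)$, $H(1,t)=\gamma_1(t)$, $H(s,0)=H(s,1)$ for all $s,t\in[0,1]$,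 which is piecewise polynomial: for some subdivisions $0=s_0<\dots<s_m=1$ and $0=t_0<\dots<t_n=1$ it is polynomial (in two variables, with coefficients in $C$) on each $[s_{j-1},s_j]\times[t_{k-1},t_k]$.
   Formalization: Over an ordered field that is not real closed, half the Cauchy index can be a non-integer and differ from Sturm's output; so w having values in Z and its computation by Sturm's algorithm are asserted only for real closed R, while independence of the subdivision is asserted for every R. *)

(* Defs.v *)
From HB Require Import structures.
From mathcomp Require Import all_boot all_order all_algebra.
From mathcomp Require Import fraction complex.
From mathcomp Require Import classical_sets fsbigop set_interval.

Set Implicit Arguments.
Unset Strict Implicit.
Unset Printing Implicit Defensive.

Import Order.TTheory GRing.Theory Num.Theory.

Local Open Scope ring_scope.
Local Open Scope complex_scope.

Definition real_closed (R : realFieldType) : Prop :=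
  forall (P : {poly R}) (a b : R), a < b -> P.[a] * P.[b] < 0 ->
    exists2 x : R, a < x < b & P.[x] = 0.

Section CauchyIndex.

Variable R : realFieldType.
Implicit Types (a b x : R) (p : {poly R}) (f : {fraction {poly R}}).

Definition frac_num f : {poly R} := \n_(repr f).
Definition frac_den f : {poly R} := \d_(repr f).

(* For p != 0, the cofactor q in p = ('X - a)^(mup a p) * q; q.[a] != 0. *)
Definition cofactor_at a p : {poly R} := p %/ ('X - a%:P) ^+ mup a p.

(* For f != 0, writing f = ('X - a)^m * g with g having neither zero nor pole
   at a, frac_order f a is m and frac_lead f a is g(a); neither depends on the
   representative of f. *)
Definition frac_order f a : int :=
  (mup a (frac_num f))%:Z - (mup a (frac_den f))%:Z.

Definition frac_lead f a : R :=
  (cofactor_at a (frac_num f)).[a] / (cofactor_at a (frac_den f)).[a].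

Definition Ind_right f a : rat :=
  if (f != 0) && (frac_order f a < 0)
  then 2^-1 * (sgz (frac_lead f a))%:~R else 0.

Definition Ind_left f a : rat :=
  if (f != 0) && (frac_order f a < 0)
  then 2^-1 * (-1) ^ frac_order f a * (sgz (frac_lead f a))%:~R else 0.

Definition Ind_at f x : rat := Ind_right f x - Ind_left f x.

(* The sum over a < x < b has finite support: Ind_at f vanishes off the poles. *)
Definition Ind a b f : rat :=
  Ind_right f a + \sum_(x \in [set` `]a, b[%R]%classic) Ind_at f x
  - Ind_left f b.

(* U / V in R(X). Inversion in {fraction _} is total with 0^-1 = 0, so this is 0
   as soon as U = 0 or V = 0, and its index is then 0. *)
Definition ratfun (U V : {poly R}) : {fraction {poly R}} := tofrac U / tofrac V.

End CauchyIndex.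

Section Sturm.

Variable R : realFieldType.
Implicit Types (a b : R) (U V P Q : {poly R}).

(* The sequence P, Q, - (P %% Q), ... up to its last nonzero term; the fuel
   [size U] in [sturm_remainders] suffices since sizes decrease strictly
   from U on. *)
Fixpoint sturm_rec (fuel : nat) P Q : seq {poly R} :=
  P :: (if fuel is fuel'.+1 then
          if Q == 0 then [::] else sturm_rec fuel' Q (- (P %% Q))
        else [::]).

Definition sturm_remainders U V : seq {poly R} := sturm_rec (size U) V U.

Definition sturm_chain U V : seq {poly R} :=
  let s := sturm_remainders U V in [seq P %/ last 0 s | P <- s].

Definition sign_variation a (s : seq {poly R}) : rat :=
  \sum_(1 <= k < size s)
     2^-1 * `|(sgz (s`_k.-1).[a])%:~R - (sgz (s`_k).[a])%:~R|.

Definition sturm U V a b : rat :=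
  if (U == 0) || (V == 0) then 0
  else sign_variation a (sturm_chain U V) - sign_variation b (sturm_chain U V).

End Sturm.

Section Loops.

Variable R : realFieldType.

Definition itv01 : Type := {t : R | 0 <= t <= 1}.

Lemma mem01_0 : 0 <= (0 : R) <= 1. Proof. by rewrite lexx ler01. Qed.
Lemma mem01_1 : 0 <= (1 : R) <= 1. Proof. by rewrite lexx ler01. Qed.

Definition t0 : itv01 := exist _ 0 mem01_0.
Definition t1 : itv01 := exist _ 1 mem01_1.

(* 0 = t 0 < ... < t n = 1; the values of t beyond n are irrelevant. *)
Definition subdivision (n : nat) (t : nat -> R) : Prop :=
  [/\ t 0 = 0, t n = 1 & forall k, (k < n)%N -> t k < t k.+1].

(* P k is the polynomial on [t k, t k.+1], for k < n. *)
Definition presents (gamma : itv01 -> R[i])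
    (n : nat) (t : nat -> R) (P : nat -> {poly R[i]}) : Prop :=
  subdivision n t /\
  forall k, (k < n)%N -> forall x : itv01, t k <= val x <= t k.+1 ->
    gamma x = (P k).[(val x)%:C].

Definition piecewise_poly (gamma : itv01 -> R[i]) : Prop :=
  exists n t P, presents gamma n t P.

Record Omega := MkOmega {
  loop :> itv01 -> R[i];
  loop_piecewise : piecewise_poly loop;
  loop_closed : loop t0 = loop t1;
  loop_neq0 : forall x, loop x != 0
}.

Definition poly_re (P : {poly R[i]}) : {poly R} := map_poly (@complex.Re R) P.
Definition poly_im (P : {poly R[i]}) : {poly R} := map_poly (@complex.Im R) P.

Definition half_cauchy_index
    (n : nat) (t : nat -> R) (P : nat -> {poly R[i]}) : rat :=
  2^-1 * \sum_(k < n) Ind (t k) (t k.+1) (ratfun (poly_re (P k)) (poly_im (P k))).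

Definition half_sturm
    (n : nat) (t : nat -> R) (P : nat -> {poly R[i]}) : rat :=
  2^-1 * \sum_(k < n) sturm (poly_re (P k)) (poly_im (P k)) (t k) (t k.+1).

Definition rect_boundary (x0 x1 y0 y1 : R) (t : itv01) : R[i] :=
  let u := val t in
  if u <= 1 / 4 then (x0 + 4 * u * (x1 - x0)) +i* y0
  else if u <= 1 / 2 then x1 +i* (y0 + (4 * u - 1) * (y1 - y0))
  else if u <= 3 / 4 then (x1 + (4 * u - 2) * (x0 - x1)) +i* y1
  else x0 +i* (y1 + (4 * u - 3) * (y0 - y1)).

(* {poly {poly R[i]}} stands for R[i][S, T], the outer variable being S. *)
Definition piecewise_poly2 (H : itv01 -> itv01 -> R[i]) : Prop :=
  exists m s n t (Q : nat -> nat -> {poly {poly R[i]}}),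
    [/\ subdivision m s, subdivision n t &
      forall j k, (j < m)%N -> (k < n)%N -> forall x y : itv01,
        s j <= val x <= s j.+1 -> t k <= val y <= t k.+1 ->
        H x y = (Q j k).[((val x)%:C)%:P].[(val y)%:C]].

Definition homotopic (gamma0 gamma1 : Omega) : Prop :=
  exists H : itv01 -> itv01 -> R[i],
    [/\ forall s t, H s t != 0,
        forall t, H t0 t = gamma0 t,
        forall t, H t1 t = gamma1 t,
        forall s, H s t0 = H s t1 &
        piecewise_poly2 H].

Lemma subdivision_le n t : subdivision n t ->
  forall i j, (i <= j <= n)%N -> t i <= t j.
Proof.
case=> _ _ tlt i; elim=> [|j IH] /andP[ij jn].
  by move: ij; rewrite leqn0 => /eqP->.
move: ij; rewrite leq_eqVlt => /orP[/eqP->//|ij].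
apply: le_trans (ltW (tlt _ jn)); apply: IH.
by rewrite -ltnS ij ltnW.
Qed.

Lemma subdivision_cell n t (L : seq R) : subdivision n t ->
  sorted <%R L -> (forall i, (i <= n)%N -> t i \in L) ->
  forall k, (k.+1 < size L)%N -> 0 <= L`_k -> L`_k.+1 <= 1 ->
  exists2 i, (i < n)%N & t i <= L`_k /\ L`_k.+1 <= t i.+1.
Proof.
move=> [h0 h1 _] Ls tL k kL k0 k1.
have lt_nth := lt_sorted_ltn_nth 0 Ls.
have kk : L`_k < L`_k.+1 by rewrite lt_nth ?inE// ltnW.
have ex : exists i, (i <= n)%N && (L`_k < t i).
  by exists n; rewrite leqnn h1 (lt_le_trans kk).
case: (ex_minnP ex) => -[|i] /andP[iN Li] mini.
  by move: Li; rewrite h0 ltNge k0.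
exists i => //; split.
  rewrite leNgt; apply/negP => Lti.
  by have := mini i; rewrite Lti (ltnW iN) ltnn => /(_ isT).
have /(nthP 0)[p pL tp] := tL _ iN.
move: Li; rewrite -tp lt_nth ?inE// ?(ltnW kL)// => kp.
by rewrite (lt_sorted_leq_nth 0 Ls) ?inE.
Qed.

Lemma subdivision_refine n t m s : subdivision n t -> subdivision m s ->
  exists l r, subdivision l r /\ forall k, (k < l)%N ->
    (exists2 i, (i < n)%N & t i <= r k /\ r k.+1 <= t i.+1) /\
    (exists2 j, (j < m)%N & s j <= r k /\ r k.+1 <= s j.+1).
Proof.
move=> tS sS; have [th0 th1 _] := tS; have [sh0 sh1 _] := sS.
pose L := sort <=%R (undup (map t (iota 0 n.+1) ++ map s (iota 0 m.+1))).
have Ls : sorted <%R L by rewrite sort_lt_sorted undup_uniq.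
have tL i : (i <= n)%N -> t i \in L.
  move=> iN; rewrite mem_sort mem_undup mem_cat; apply/orP; left.
  by apply: map_f; rewrite mem_iota.
have sL i : (i <= m)%N -> s i \in L.
  move=> iN; rewrite mem_sort mem_undup mem_cat; apply/orP; right.
  by apply: map_f; rewrite mem_iota.
have L01 x : x \in L -> 0 <= x <= 1.
  rewrite mem_sort mem_undup mem_cat.
  case/orP => /mapP; case=> i; rewrite mem_iota /= add0n ltnS => iN ->.
    by rewrite -th0 -th1 !(subdivision_le tS) ?iN ?leqnn.
  by rewrite -sh0 -sh1 !(subdivision_le sS) ?iN ?leqnn.
have L0 : (0 < size L)%N by have := tL 0 isT; case: (L).
have kL k : (k < size L)%N -> 0 <= L`_k <= 1.
  by move=> kL; apply: L01; apply: mem_nth.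
exists (size L).-1, (nth 0 L); split; last first.
  move=> k; rewrite -ltnS prednK// => kS.
  have /andP[k0 _] := kL _ (ltnW kS); have /andP[_ k1] := kL _ kS.
  by split; apply: subdivision_cell.
have lastL : ((size L).-1 < size L)%N by rewrite prednK.
split.
- apply/eqP; rewrite eq_le; have /andP[-> _] := kL _ L0; rewrite andbT.
  have := tL 0 isT; rewrite th0 => /(nthP 0)[p pL {2}<-].
  by rewrite (lt_sorted_leq_nth 0 Ls) ?inE.
- apply/eqP; rewrite eq_le; have /andP[_ ->] := kL _ lastL => /=.
  have := tL n (leqnn n); rewrite th1 => /(nthP 0)[p pL {1}<-].
  by rewrite (lt_sorted_leq_nth 0 Ls) ?inE// -ltnS prednK.
- move=> k; rewrite -ltnS prednK// => kS.
  by rewrite (lt_sorted_ltn_nth 0 Ls) ?inE// ltnW.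
Qed.

Lemma piecewise_polyM (g h : itv01 -> R[i]) :
  piecewise_poly g -> piecewise_poly h -> piecewise_poly (fun x => g x * h x).
Proof.
move=> [n [t [P [tS gP]]]] [m [s [Q [sS hQ]]]].
have [l [r [rS rP]]] := subdivision_refine tS sS.
have cellP k (lt_kl : (k < l)%N) : exists ij : nat * nat,
    [&& (ij.1 < n)%N, (ij.2 < m)%N, t ij.1 <= r k, r k.+1 <= t ij.1.+1,
        s ij.2 <= r k & r k.+1 <= s ij.2.+1].
  have [[i iN [i1 i2]] [j jN [j1 j2]]] := rP k lt_kl.
  by exists (i, j); rewrite iN jN i1 i2 j1 j2.
pose c k := if insub k is Some k' then xchoose (cellP (val (k' : 'I_l)) (ltn_ord k'))
            else (0, 0)%N.
exists l, r, (fun k => P (c k).1 * Q (c k).2); split=> // k kl x /andP[x1 x2].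
rewrite /c insubT /=; set ij := xchoose _.
have /and5P[iN jM i1 i2 /andP[j1 j2]] := xchooseP (cellP k (ltn_ord (Ordinal kl))).
rewrite hornerM -(gP _ iN) ?(le_trans i1 x1) ?(le_trans x2 i2)//.
by rewrite -(hQ _ jM) ?(le_trans j1 x1) ?(le_trans x2 j2).
Qed.

Definition loop_mul (gamma1 gamma2 : Omega) : Omega.
Proof.
apply: (@MkOmega (fun x => gamma1 x * gamma2 x)).
- by apply: piecewise_polyM; apply: loop_piecewise.
- by rewrite !loop_closed.
- by move=> x; rewrite mulf_neq0 ?loop_neq0.
Defined.

Implicit Types w : Omega -> int.

Definition computed_by_cauchy_index w : Prop :=
  forall (gamma : Omega) n t P, presents gamma n t P ->
    (w gamma)%:~R = half_cauchy_index n t P.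

Definition computed_by_sturm w : Prop :=
  forall (gamma : Omega) n t P, presents gamma n t P ->
    (w gamma)%:~R = half_sturm n t P.

Definition normalization w : Prop :=
  forall x0 x1 y0 y1 : R, x0 < x1 -> y0 < y1 ->
  forall gamma : Omega, gamma =1 rect_boundary x0 x1 y0 y1 ->
    (x0 < 0 < x1 /\ y0 < 0 < y1 -> w gamma = 1) /\
    (~ (x0 <= 0 <= x1 /\ y0 <= 0 <= y1) -> w gamma = 0).

Definition multiplicativity w : Prop :=
  forall gamma1 gamma2 : Omega,
    w (loop_mul gamma1 gamma2) = w gamma1 + w gamma2.

Definition homotopy_invariance w : Prop :=
  forall gamma0 gamma1 : Omega, homotopic gamma0 gamma1 -> w gamma0 = w gamma1.

End Loops.

(* Main.v *)
From HB Require Import structures.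
Require Import Defs.
From mathcomp Require Import all_boot all_order all_algebra.
From mathcomp Require Import fraction complex generic_quotient ring lra zify polyXY polyrcf.
From mathcomp Require Import boolp classical_sets functions cardinality fsbigop set_interval.

(* The open upper and lower half planes and the two real half lines cut C^* into
   four pieces, and twice the Cauchy index of re/im counts, with signs, the
   quarter turns of a path between these pieces. Over a real closed field every
   identity between such indices can be checked on intervals without roots of the
   polynomials involved: there the index only depends on signs at the endpoints
   and at one interior point. This gives the reciprocity formula (hence Sturm's
   algorithm), and additivity under multiplication up to a term depending on the
   endpoints only.

   Homotopy invariance: for a polynomial map without zeros on a rectangle, the
   index along the boundary vanishes. It vanishes on thin strips, where the zeros
   of im and re stay apart, and Sturm's algorithm with parameters shows that the
   index along s = const is constant away from finitely many values of s, so the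
   strips suffice although R need not be archimedean.

   Conversely, suppose that w has the three properties and that P, of degree n,
   has no root. Its homogenization deforms the constant loop P(0) to lc(P) g^n,
   where g runs once around 0; hence n = 0. So R[i] is algebraically closed and R
   is real closed. Finally a loop of index 0 has a direction, rounded to a quarter
   turn, which lifts to an integer function that closes up; cutting off its
   highest level repeatedly deforms the loop to a constant, so w vanishes on it,
   and multiplicativity gives the general case. *)

Set Implicit Arguments.
Unset Strict Implicit.
Unset Printing Implicit Defensive.

Import Order.TTheory GRing.Theory Num.Theory.

Local Open Scope ring_scope.
Local Open Scope complex_scope.

(** * Cauchy indices of fractions *)

Lemma frac_numdenE (R : realFieldType) (f : {fraction {poly R}}) :
  f = tofrac (frac_num f) / tofrac (frac_den f).
Proof.
rewrite /frac_num /frac_den -[LHS]reprK; set x := repr f.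
rewrite -[RHS]/(FracField.mul _ (FracField.inv _)) !piE.
rewrite /FracField.mulf /FracField.invf !numden_Ratio ?oner_eq0 ?denom_ratioP//.
by rewrite mulr1 mul1r FracField.Ratio_numden.
Qed.

Section FractionIndex.
Variable R : realFieldType.
Implicit Types (a b x : R) (p q U V : {poly R}) (f : {fraction {poly R}}).

Lemma frac_den_neq0 f : frac_den f != 0.
Proof. exact: denom_ratioP. Qed.

(** [frac_num] and [frac_den] belong to a chosen representative of the class. Cross multiplication
    is its only link with [U] and [V], and it is enough to compute orders and leading values from
    [U] and [V] themselves. *)
Lemma ratfun_cross U V : V != 0 ->
  frac_num (ratfun U V) * V = U * frac_den (ratfun U V).
Proof.
move=> V0; apply/eqP; rewrite -tofrac_eq !tofracM -eqr_div ?tofrac_eq0 ?frac_den_neq0//.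
by apply/eqP; rewrite -[LHS]frac_numdenE.
Qed.

Lemma ratfun_eq0 U V : (ratfun U V == 0) = (U == 0) || (V == 0).
Proof. by rewrite /ratfun mulf_eq0 invr_eq0 !tofrac_eq0. Qed.

Lemma cofactor_atE a p : p = cofactor_at a p * ('X - a%:P) ^+ mup a p.
Proof.
rewrite /cofactor_at; have [->|p0] := eqVneq p 0; first by rewrite div0p mul0r.
by rewrite divpK// -mup_geq.
Qed.

Lemma cofactor_at_neq0 a p : p != 0 -> (cofactor_at a p).[a] != 0.
Proof.
move=> p0; apply: contraTneq (ltnSn (mup a p)) => /eqP.
rewrite -[_ == 0]/(root _ _) -dvdp_XsubCl => dv.
by rewrite mup_ltn// negbK [X in _ %| X](cofactor_atE a) exprS dvdp_mul2r// expf_neq0// polyXsubC_eq0.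
Qed.

Lemma cofactor_atM a p q : p != 0 -> q != 0 ->
  (cofactor_at a (p * q)).[a] = (cofactor_at a p).[a] * (cofactor_at a q).[a].
Proof.
move=> p0 q0; rewrite -hornerM; congr _.[_].
apply: (@mulIf _ (('X - a%:P) ^+ mup a (p * q))).
  by rewrite expf_neq0// polyXsubC_eq0.
rewrite -cofactor_atE mupM// exprD mulrACA.
by rewrite -!cofactor_atE.
Qed.

Lemma cofactor_at_id a p : p.[a] != 0 -> (cofactor_at a p).[a] = p.[a].
Proof.
move=> pa; have /mupNroot m0 : ~~ root p a by [].
by rewrite [in RHS](cofactor_atE a p) m0 expr0 mulr1.
Qed.

Definition idx a b U V : rat := Ind a b (ratfun U V).

Lemma frac_num_ratfun_neq0 U V : U != 0 -> V != 0 ->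
  frac_num (ratfun U V) != 0.
Proof.
move=> U0 V0; have f0 : ratfun U V != 0 by rewrite ratfun_eq0 negb_or U0.
apply: contraNneq f0 => n0.
by rewrite [ratfun U V]frac_numdenE n0 tofrac0 mul0r.
Qed.

Lemma frac_order_ratfun a U V : U != 0 -> V != 0 ->
  frac_order (ratfun U V) a = (mup a U)%:Z - (mup a V)%:Z.
Proof.
move=> U0 V0; have n0 := frac_num_ratfun_neq0 U0 V0.
have := congr1 (mup a) (ratfun_cross U V0).
rewrite !mupM// ?frac_den_neq0// /frac_order; lia.
Qed.

Lemma frac_lead_ratfun a U V : U != 0 -> V != 0 ->
  frac_lead (ratfun U V) a = (cofactor_at a U).[a] / (cofactor_at a V).[a].
Proof.
move=> U0 V0; have n0 := frac_num_ratfun_neq0 U0 V0.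
have /(congr1 (fun p => (cofactor_at a p).[a])) := ratfun_cross U V0.
rewrite !cofactor_atM// ?frac_den_neq0// /frac_lead => e.
by apply/eqP; rewrite eqr_div ?cofactor_at_neq0 ?frac_den_neq0//; apply/eqP.
Qed.

Lemma ratfun0l V : ratfun 0 V = 0.
Proof. by rewrite /ratfun tofrac0 mul0r. Qed.

Lemma ratfun0r U : ratfun U 0 = 0.
Proof. by rewrite /ratfun tofrac0 invr0 mulr0. Qed.

Lemma ratfunMr (D U V : {poly R}) : D != 0 -> ratfun (U * D) (V * D) = ratfun U V.
Proof.
move=> D0; rewrite /ratfun !tofracM invfM mulrACA.
by rewrite divff ?tofrac_eq0// mulr1.
Qed.

Lemma Ind_right0 a : Ind_right (0 : {fraction {poly R}}) a = 0.
Proof. by rewrite /Ind_right eqxx. Qed.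

Lemma Ind_left0 a : Ind_left (0 : {fraction {poly R}}) a = 0.
Proof. by rewrite /Ind_left eqxx. Qed.

Lemma Ind_at0 x : Ind_at (0 : {fraction {poly R}}) x = 0.
Proof. by rewrite /Ind_at Ind_right0 Ind_left0. Qed.

Lemma Ind0 a b : Ind a b (0 : {fraction {poly R}}) = 0.
Proof.
rewrite /Ind Ind_right0 Ind_left0 fsbig1 ?addr0// => x _; exact: Ind_at0.
Qed.

Lemma Ind_regular U V x : V.[x] != 0 ->
  Ind_right (ratfun U V) x = 0 /\ Ind_left (ratfun U V) x = 0.
Proof.
move=> Vx; have V0 : V != 0 by apply: contraNneq Vx => ->; rewrite horner0.
have [->|U0] := eqVneq U 0; first by rewrite ratfun0l Ind_right0 Ind_left0.
rewrite /Ind_right /Ind_left frac_order_ratfun//.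
have -> : mup x V = 0 by apply: mupNroot.
by rewrite subr0 ltNge /= andbF.
Qed.

(** [Ind_at f] vanishes off the finitely many roots of the denominator. This makes the sum over an
    infinite interval an honest finite sum that can be split. *)
Lemma Ind_at_finite f a b :
  finite_set ([set` `]a, b[%R] `&` (Ind_at f) @^-1` [set~ 0])%classic.
Proof.
pose D := frac_den f.
have [s sP] : exists s : seq R, forall x, D.[x] = 0 -> x \in s.
  have := frac_den_neq0 f; rewrite -/D.
  move: (leqnn (size D)); move: {2}(size D) => n; move: D => {}D.
  elim: n D => [|n IH] D; first by rewrite size_poly_leq0 => /eqP->; rewrite eqxx.
  move=> sD D0; have [[x Dx]|nr] := pselect (exists x, D.[x] = 0); last first.
    by exists [::] => x Dx; case: nr; exists x.
  have /factor_theorem[Q DQ] : root D x by apply/eqP.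
  have Q0 : Q != 0 by apply: contraNneq D0; rewrite DQ => ->; rewrite mul0r.
  have sQ : (size Q <= n)%N.
    by move: sD; rewrite DQ size_Mmonic ?monicXsubC// size_XsubC addn2.
  have [s sP] := IH _ sQ Q0; exists (x :: s) => y; rewrite DQ hornerM hornerXsubC.
  move/eqP; rewrite mulf_eq0 inE => /orP[/eqP/sP->|]; first by rewrite orbT.
  by rewrite subr_eq0 => ->.
apply: (@sub_finite_set _ _ [set` s]%classic); last exact: finite_seq.
move=> x [_ /= fx]; apply: sP; apply: contra_notP fx => /eqP Dx.
have [r l] := Ind_regular (frac_num f) Dx.
by rewrite /Ind_at [f]frac_numdenE r l subrr.
Qed.

(** The one-sided terms [- Ind_left f b] and [Ind_right f b] at the cut add up to [Ind_at f b], the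
    summand that the two open intervals miss. *)
Lemma Ind_split a b c f : a < b -> b < c -> Ind a c f = Ind a b f + Ind b c f.
Proof.
move=> ab bc; rewrite /Ind.
have -> : \sum_(x \in `]a, c[%classic) Ind_at f x =
   \sum_(x \in `]a, b[%classic) Ind_at f x + Ind_at f b +
   \sum_(x \in `]b, c[%classic) Ind_at f x.
  have <- : \sum_(x \in [set b]%classic) Ind_at f x = Ind_at f b by rewrite fsbig_set1.
  (* The unions are formed only after restricting each sum to its support, since splitting a sum
     over a union requires finite sets. *)
  rewrite [LHS]fsbig_supp [X in _ = X + _ + _]fsbig_supp [X in _ = _ + X]fsbig_supp.
  rewrite -fsbigU0 ?finite_set1//; [|exact: Ind_at_finite|]; last first.
    by move=> x [[/= + _] xb]; rewrite xb in_itv/= ltxx andbF.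
  rewrite -fsbigU0 ?finite_setU//; [|by split; [exact: Ind_at_finite|exact:finite_set1]|exact: Ind_at_finite|]; last first.
    move=> x [[[/= + _]|->]]; rewrite /= !in_itv/=; last by rewrite ltxx => -[].
    by move=> /andP[_ xb] [/andP[bx _] _]; move: (lt_trans xb bx); rewrite ltxx.
  rewrite [LHS]fsbig_supp [in RHS]fsbig_supp; apply: eq_fsbigl.
  apply/seteqP; split=> x /=; rewrite !in_itv/=.
    move=> [[/andP[ax xc] nz] _]; split=> //.
    by have [xb|bx|->] := ltgtP x b; [left; left|right|left; right]; rewrite ?ax ?xb ?bx ?xc.
  move=> [[[[/andP[ax xb] nz]|->]|[/andP[bx xc] nz]] nz']; do 2 split=> //.
  - by rewrite ax (lt_trans xb bc).
  - by rewrite ab bc.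
  - by rewrite xc (lt_trans ab bx).
rewrite /Ind_at; ring.
Qed.

Lemma idx_split a b c U V : a < b -> b < c -> idx a c U V = idx a b U V + idx b c U V.
Proof. exact: Ind_split. Qed.

(** Cutting at a root of [D] leaves fewer roots in each piece, so the process ends on intervals
    without inner roots. Over a field without completeness this takes the place of compactness
    arguments. *)
Lemma split_ind (D : {poly R}) (P : R -> R -> Prop) : D != 0 ->
  (forall a b c, a < b -> b < c -> P a b -> P b c -> P a c) ->
  (forall a b, a < b -> (forall x, a < x < b -> D.[x] != 0) -> P a b) ->
  forall a b, a < b -> P a b.
Proof.
move=> D0 Pcat Pbase.
(* The number of inner roots is bounded through all duplicate-free lists of such roots, so the set
   of roots need not be computed. *)
suff H n a b : a < b -> (forall s, uniq s -> all (root D) s ->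
    all (fun x => a < x < b) s -> (size s <= n)%N) -> P a b.
  move=> a b ab; apply: (H (size D)) => // s us rs _.
  by apply: ltnW; apply: max_poly_roots.
elim: n a b => [|n IH] a b ab sP.
  apply: Pbase => // x xab; apply/eqP => Dx.
  have := sP [:: x] isT; rewrite /= !andbT /root Dx eqxx xab => /(_ isT isT); by rewrite ltnn.
have [[r rab Dr]|nr] := pselect (exists2 r, a < r < b & D.[r] = 0); last first.
  by apply: Pbase => // x xab; apply/eqP => Dx; apply: nr; exists x.
have /andP[ar rb] := rab.
have rD : root D r by apply/eqP.
apply: (Pcat a r b) => //; apply: IH => // s us rs sab.
- have /= := sP (r :: s); rewrite us rD rs rab/= andbT ltnS; apply=> //.
    by apply/negP => /(allP sab); rewrite ltxx andbF.
  by apply/allP => x /(allP sab) /andP[-> xr]; rewrite (lt_trans xr rb).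
- have /= := sP (r :: s); rewrite us rD rs rab/= andbT ltnS; apply=> //.
    by apply/negP => /(allP sab); rewrite ltxx.
  by apply/allP => x /(allP sab) /andP[rx ->]; rewrite (lt_trans ar rx).
Qed.

End FractionIndex.

(** * Signs of polynomials over a real closed field *)

Section Signs.
Variable R : realFieldType.
Hypothesis rcR : real_closed R.
Implicit Types (a b x m : R) (p q U V : {poly R}).

Local Notation sg x := ((sgz x)%:~R : rat).

Lemma sgz_noroot p a b x y : (forall z, a < z < b -> p.[z] != 0) ->
  a < x < b -> a < y < b -> sgz p.[x] = sgz p.[y].
Proof.
move=> nr.
wlog xy : x y / x < y => [W xab yab|/andP[ax xb] /andP[ay yb]].
  by have [xy|yx|->//] := ltgtP x y; [exact: W|rewrite (W y x)].
have px : p.[x] != 0 by apply: nr; rewrite ax.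
have py : p.[y] != 0 by apply: nr; rewrite ay.
have [/(rcR xy)[z /andP[xz zy] pz]|] := ltP (p.[x] * p.[y]) 0.
  by have := nr z; rewrite (lt_trans ax xz) (lt_trans zy yb) pz eqxx => /(_ isT).
rewrite -[0 <= _]sgz_ge0 sgzM => h; move: px py h.
by case: sgzP => //; case: sgzP.
Qed.

(** A nonzero value at [x] of the sign opposite to [p.[m]] would force a root strictly between [x]
    and [m], hence inside the interval, even if [x] is an endpoint. *)
Lemma sgz_noroot_end p a b m x : (forall z, a < z < b -> p.[z] != 0) ->
  a < m < b -> a <= x <= b -> p.[x] = 0 \/ sgz p.[x] = sgz p.[m].
Proof.
move=> nr mab /andP[ax xb]; have /andP[am mb] := mab.
have [px0|px] := eqVneq p.[x] 0; [by left|right].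
have [xm|mx|->//] := ltgtP x m.
  have [/(rcR xm)[z /andP[xz zm] pz]|] := ltP (p.[x] * p.[m]) 0.
    have := nr z; rewrite (le_lt_trans ax xz) (lt_trans zm mb) pz eqxx.
    by move=> /(_ isT).
  rewrite -[0 <= _]sgz_ge0 sgzM => h; move: px (nr m mab) h.
  by case: sgzP => //; case: sgzP.
have [/(rcR mx)[z /andP[mz zx] pz]|] := ltP (p.[m] * p.[x]) 0.
  have := nr z; rewrite (lt_trans am mz) (lt_le_trans zx xb) pz eqxx.
  by move=> /(_ isT).
rewrite -[0 <= _]sgz_ge0 sgzM => h; move: px (nr m mab) h.
by case: sgzP => //; case: sgzP.
Qed.

Lemma noroot_neq0 p a b m : (forall z, a < z < b -> p.[z] != 0) ->
  a < m < b -> p != 0.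
Proof. by move=> nr /nr; apply: contraNneq => ->; rewrite horner0. Qed.

(** The removed power of ['X - a%:P] is positive to the right of [a]. In the mirror statement at [b]
    it has the sign of a power of -1. *)
Lemma sgz_cofactor_right p a b m : (forall z, a < z < b -> p.[z] != 0) ->
  a < m < b -> sgz (cofactor_at a p).[a] = sgz p.[m].
Proof.
move=> nr mab; have /andP[am mb] := mab; have p0 := noroot_neq0 nr mab.
have nrq z : a < z < b -> (cofactor_at a p).[z] != 0.
  move=> /nr; apply: contraNneq => q0.
  by rewrite [p](cofactor_atE a) hornerM q0 mul0r.
have aab : a <= a <= b by rewrite lexx ltW// (lt_trans am mb).
have [/eqP|->] := sgz_noroot_end nrq mab aab.
  by rewrite (negPf (cofactor_at_neq0 a p0)).
rewrite [in RHS](cofactor_atE a p) hornerM sgzM horner_exp hornerXsubC sgzX.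
by rewrite (gtr0_sgz (x := m - a)) ?subr_gt0// expr1n mulr1.
Qed.

Lemma sgz_cofactor_left p a b m : (forall z, a < z < b -> p.[z] != 0) ->
  a < m < b -> sgz (cofactor_at b p).[b] = (-1) ^+ mup b p * sgz p.[m].
Proof.
move=> nr mab; have /andP[am mb] := mab; have p0 := noroot_neq0 nr mab.
have nrq z : a < z < b -> (cofactor_at b p).[z] != 0.
  move=> /nr; apply: contraNneq => q0.
  by rewrite [p](cofactor_atE b) hornerM q0 mul0r.
have bab : a <= b <= b by rewrite lexx andbT ltW// (lt_trans am mb).
have [/eqP|->] := sgz_noroot_end nrq mab bab.
  by rewrite (negPf (cofactor_at_neq0 b p0)).
rewrite [X in _ * sgz X.[_]](cofactor_atE b p) hornerM sgzM horner_exp hornerXsubC sgzX.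
rewrite (ltr0_sgz (x := m - b)) ?subr_lt0// mulrCA -exprMn mulrNN mulr1.
by rewrite expr1n mulr1.
Qed.

Lemma sg_div x y : sgz (x / y) = sgz x * sgz y.
Proof.
have [->|y0] := eqVneq y 0; first by rewrite invr0 mulr0 sgz0 mulr0.
apply: (@mulIf _ (sgz y)); first by rewrite sgz_eq0.
by rewrite -sgzM divfK// -mulrA mulz_sg y0 mulr1.
Qed.

Lemma mup_root_gt0 p a : p != 0 -> p.[a] = 0 -> (0 < mup a p)%N.
Proof. by move=> p0 pa; rewrite -XsubC_dvd// dvdp_XsubCl; apply/eqP. Qed.

(** Without inner poles only the endpoints count, and there a zero of [V] is a pole because [U] does
    not vanish. At [b] the sign in [Ind_left] cancels the one from the cofactor of [V]. All later
    index identities reduce to this formula. *)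
Lemma idx_base a b m U V : a < m < b ->
  (V.[a] = 0 -> U.[a] != 0) -> (V.[b] = 0 -> U.[b] != 0) ->
  (V = 0 \/ forall x, a < x < b -> V.[x] != 0) ->
  2 * idx a b U V = sg V.[m] *
    ((V.[a] == 0)%:R * sg U.[a] - (V.[b] == 0)%:R * sg U.[b]).
Proof.
move=> mab coa cob [->|nr].
  by rewrite /idx ratfun0r Ind0 horner0 sgz0 mul0r mulr0.
have V0 := noroot_neq0 nr mab.
rewrite /idx /Ind fsbig1 ?addr0 => [|x]; last first.
  rewrite /= in_itv => /= /nr Vx.
  by have [r l] := Ind_regular U Vx; rewrite /Ind_at r l subrr.
have -> : 2 * (Ind_right (ratfun U V) a - Ind_left (ratfun U V) b) =
  2 * Ind_right (ratfun U V) a - 2 * Ind_left (ratfun U V) b by ring.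
rewrite mulrBr; congr (_ - _).
- have [Va|Va] := eqVneq V.[a] 0; last first.
    by have [-> _] := Ind_regular U Va; rewrite mul0r !mulr0.
  have Ua := coa Va; have U0 : U != 0 by apply: contraNneq Ua => ->; rewrite horner0.
  rewrite /Ind_right ratfun_eq0 negb_or U0 V0/= frac_order_ratfun//.
  rewrite (mupNroot (q := U)) // sub0r oppr_lt0 ltz_nat mup_root_gt0//.
  rewrite frac_lead_ratfun// sg_div cofactor_at_id// (sgz_cofactor_right nr mab).
  by rewrite intrM; field.
- have [Va|Va] := eqVneq V.[b] 0; last first.
    by have [_ ->] := Ind_regular U Va; rewrite mul0r !mulr0.
  have Ua := cob Va; have U0 : U != 0 by apply: contraNneq Ua => ->; rewrite horner0.
  rewrite /Ind_left ratfun_eq0 negb_or U0 V0/= frac_order_ratfun//.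
  rewrite (mupNroot (q := U)) // sub0r oppr_lt0 ltz_nat mup_root_gt0//.
  rewrite frac_lead_ratfun// sg_div cofactor_at_id// (sgz_cofactor_left nr mab).
  rewrite -exprnN -exprVn invrN1 !intrM rmorphXn rmorphN1 -signr_odd /=.
  by case: odd; rewrite ?expr0 ?expr1; field.
Qed.

End Signs.

(** * Reciprocity and product formulas *)

Section Formulas.
Variable R : realFieldType.
Hypothesis rcR : real_closed R.
Implicit Types (a b x m : R) (p q U V W : {poly R}).

Local Notation sg x := ((sgz x)%:~R : rat).

(** Instance of [split_ind] for the product of the nonzero members of [ps]. The bounds on [u] and
    [v] let hypotheses made on the whole interval pass to the pieces, and [m] is a sample point for
    the inner signs. *)
Lemma split_ind_in (ps : seq {poly R}) a b (P : R -> R -> Prop) : a < b ->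
  (forall u v w, a <= u -> u < v -> v < w -> w <= b -> P u v -> P v w -> P u w) ->
  (forall u v m, a <= u -> u < m < v -> v <= b ->
    (forall p, p \in ps -> p = 0 \/ forall x, u < x < v -> p.[x] != 0) -> P u v) ->
  P a b.
Proof.
move=> ab Pcat Pbase; pose nz p : {poly R} := if p == 0 then 1 else p.
pose D : {poly R} := \prod_(p <- ps) nz p.
have D0 : D != 0.
  rewrite prodf_seq_neq0; apply/allP => p _ /=; rewrite /nz.
  by case: ifPn => // _; exact: oner_neq0.
suff : a <= a -> b <= b -> P a b by apply.
apply: (split_ind (P := fun u v => a <= u -> v <= b -> P u v) D0) => // [u v w uv vw Puv Pvw au wb|u v uv nr au vb].
  apply: (Pcat u v w) => //; [apply: Puv|apply: Pvw] => //.
    exact: le_trans (ltW vw) wb.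
  exact: le_trans au (ltW uv).
apply: (Pbase u v ((u + v) / 2)) => // [|p pps]; first by rewrite !midf_lt.
have [->|p0] := eqVneq p 0; [by left|right => x /nr].
rewrite /D horner_prod prodf_seq_neq0 => /allP/(_ _ pps).
by rewrite /nz (negPf p0).
Qed.

Lemma sgz_end p u v m x : (p = 0 \/ forall z, u < z < v -> p.[z] != 0) ->
  u < m < v -> u <= x <= v -> p.[x] = 0 \/ sgz p.[x] = sgz p.[m].
Proof. by move=> [->|nr] muv xuv; [left; rewrite horner0|apply: (sgz_noroot_end rcR nr)]. Qed.

Definition coprime_on a b U V := forall x, a <= x <= b -> V.[x] = 0 -> U.[x] != 0.

Lemma coprime_onC a b U V : coprime_on a b U V -> coprime_on a b V U.
Proof. by move=> co x /co c Ux; apply/eqP => /c; rewrite Ux eqxx. Qed.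

Lemma coprime_on_sub a b u v U V : a <= u -> v <= b ->
  coprime_on a b U V -> coprime_on u v U V.
Proof.
move=> au vb co x /andP[ux xv]; apply: co.
by rewrite (le_trans au ux) (le_trans xv vb).
Qed.

Lemma idx_cell u v m U V : coprime_on u v U V -> u < m < v ->
  (V = 0 \/ forall x, u < x < v -> V.[x] != 0) ->
  2 * idx u v U V = sg V.[m] *
    ((V.[u] == 0)%:R * sg U.[u] - (V.[v] == 0)%:R * sg U.[v]).
Proof.
move=> co muv; have /andP[um mv] := muv; have uv := ltW (lt_trans um mv).
by apply: (idx_base rcR muv); apply: co; rewrite lexx uv.
Qed.

(** On a piece without inner roots, each endpoint satisfies an identity between signs at that point
    and at [m]. The difference of the two endpoint identities is the claim. *)
Lemma idx_reciprocity a b U V : a < b -> coprime_on a b U V ->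
  2 * idx a b U V + 2 * idx a b V U = sg (U.[b] * V.[b]) - sg (U.[a] * V.[a]).
Proof.
move=> ab co.
pattern a, b; apply: (split_ind_in (ps := [:: U; V]) ab) => [u v w _ uv vw _ e1 e2|u v m au umv vb nr].
  by rewrite !(idx_split _ _ uv vw); lra.
have cuv := coprime_on_sub au vb co.
have /andP[um mv] := umv; have uv := ltW (lt_trans um mv).
have nU := nr U (mem_head _ _).
have nV : V = 0 \/ forall x, u < x < v -> V.[x] != 0.
  by apply: nr; rewrite !inE eqxx orbT.
rewrite (idx_cell cuv umv nV) (idx_cell (coprime_onC cuv) umv nU).
(* The term [sg U.[m] * sg V.[m]] is common to both endpoints and drops out of the difference. *)
have H x : u <= x <= v -> sg V.[m] * ((V.[x] == 0)%:R * sg U.[x]) +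
    sg U.[m] * ((U.[x] == 0)%:R * sg V.[x]) = sg U.[m] * sg V.[m] - sg (U.[x] * V.[x]).
  move=> xuv; have cx := cuv x xuv.
  have [Vx|Vx] := eqVneq V.[x] 0.
    have [/eqP|->] := sgz_end nU umv xuv; first by rewrite (negPf (cx Vx)).
    by rewrite (negPf (cx Vx)) Vx mulr0 sgz0 /=; ring.
  have [/eqP|<- //] := sgz_end nV umv xuv; first by rewrite (negPf Vx).
  rewrite sgzM intrM; have [->|Ux] := eqVneq U.[x] 0; first by rewrite sgz0 /=; ring.
  have [/eqP|->] := sgz_end nU umv xuv; first by rewrite (negPf Ux).
  by rewrite /=; ring.
have := H u; have := H v; rewrite !lexx uv => /(_ isT) hv /(_ isT) hu.
rewrite !mulrBr; lra.
Qed.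

(** The index only sees the sign of the numerator at the zeros of the denominator. In a euclidean
    division the dividend and the negated remainder have opposite signs there, which is the step of
    Sturm's algorithm. *)
Lemma idx_congr a b U V W : a < b ->
  (forall x, a <= x <= b -> U.[x] = 0 -> V.[x] != 0 /\ sgz V.[x] = - sgz W.[x]) ->
  idx a b V U = - idx a b W U.
Proof.
move=> ab co; apply: (@mulfI _ 2) => //; rewrite mulrN.
have cV : coprime_on a b V U by move=> x xab /(co x xab)[].
have cW : coprime_on a b W U.
  move=> x xab /(co x xab)[+ e]; rewrite -sgz_eq0 e oppr_eq0 sgz_eq0; exact.
pattern a, b; apply: (split_ind_in (ps := [:: U]) ab) => [u v w _ uv vw _ e1 e2|u v m au umv vb nr].
  by rewrite !(idx_split _ _ uv vw); lra.
have /andP[um mv] := umv; have uv := ltW (lt_trans um mv).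
rewrite (idx_cell (coprime_on_sub au vb cV) umv (nr U _)) ?mem_head//.
rewrite (idx_cell (coprime_on_sub au vb cW) umv (nr U _)) ?mem_head//.
have H x : u <= x <= v -> (U.[x] == 0)%:R * sg V.[x] = - ((U.[x] == 0)%:R * sg W.[x]).
  move=> /andP[ux xv]; have [Ux|] := eqVneq U.[x] 0; last by rewrite !mul0r oppr0.
  by rewrite (co x _ Ux).2 ?rmorphN/= ?mulrN// (le_trans au ux) (le_trans xv vb).
by rewrite (H u) ?lexx// (H v) ?lexx ?uv//; ring.
Qed.

Lemma idx_noroot a b U V : a < b -> (forall x, a <= x <= b -> V.[x] != 0) ->
  idx a b U V = 0.
Proof.
move=> ab nr; apply: (@mulfI _ 2) => //; rewrite mulr0.
rewrite (@idx_cell a b ((a + b) / 2)) ?midf_lt//.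
- by rewrite !(negPf (nr _ _)) ?lexx ?ltW// !mul0r subrr mulr0.
- by move=> x /nr Vx /eqP; rewrite (negPf Vx).
- by right=> x /andP[ax xb]; rewrite nr// !ltW.
Qed.

Lemma idx_num_noroot a b U V : a < b -> (forall x, a <= x <= b -> U.[x] != 0) ->
  2 * idx a b U V = sg (U.[b] * V.[b]) - sg (U.[a] * V.[a]).
Proof.
move=> ab nU; rewrite -(idx_reciprocity ab); last by move=> x /nU.
by rewrite (idx_noroot _ ab nU) mulr0 addr0.
Qed.

(** For equal nonzero signs the last term removes one of the two copies; for opposite signs the
    first two terms cancel and the product of signs is -1. *)
Lemma sgz_add_carry (x y : R) :
  sg (x + y) = sg x + sg y - sg x * sg y * sg (x + y).
Proof.
case: (sgzP x) => [->|x0|x0]; first by rewrite add0r; ring.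
  case: (sgzP y) => [->|y0|y0]; first by rewrite addr0 gtr0_sgz//; ring.
    by rewrite gtr0_sgz ?addr_gt0//.
  by ring.
case: (sgzP y) => [->|y0|y0]; first by rewrite addr0 ltr0_sgz//; ring.
  by ring.
by rewrite (ltr0_sgz (x := x + y)) ?ltrDl ?(lt_trans _ x0) ?gtrDl//; lra.
Qed.

Lemma sg_sqr (x : R) : x != 0 -> sg x * sg x = 1.
Proof. by rewrite -intrM mulz_sg => ->. Qed.

(** Contribution of one endpoint to the product formula. Plain letters are values at the endpoint,
    primed ones values at an inner point of the piece, so that signs agree unless the endpoint value
    is 0. The cases are the vanishing of [y1], [y2] and [Y]. *)
Lemma product_end (x1 y1 x2 y2 x1' y1' x2' y2' : R)
    (X := x1 * x2 - y1 * y2) (Y := x1 * y2 + x2 * y1)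
    (Y' := x1' * y2' + x2' * y1') :
  (x1 = 0 \/ sgz x1 = sgz x1') -> (y1 = 0 \/ sgz y1 = sgz y1') ->
  (x2 = 0 \/ sgz x2 = sgz x2') -> (y2 = 0 \/ sgz y2 = sgz y2') ->
  (Y = 0 \/ sgz Y = sgz Y') ->
  (y1 = 0 -> x1 != 0) -> (y2 = 0 -> x2 != 0) ->
  sg Y' * ((Y == 0)%:R * sg X) =
    sg y1' * ((y1 == 0)%:R * sg x1) + sg y2' * ((y2 == 0)%:R * sg x2)
    - sg (y1' * y2' * Y') + sg (y1 * y2 * Y).
Proof.
move=> ex1 ey1 ex2 ey2 eY co1 co2; rewrite !sgzM !intrM.
have [y10|y10] := eqVneq y1 0; have [y20|y20] := eqVneq y2 0 => /=.
- have x10 := co1 y10; have x20 := co2 y20.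
  have sx1 : sgz x1 = sgz x1' by case: ex1 => // /eqP; rewrite (negPf x10).
  have sx2 : sgz x2 = sgz x2' by case: ex2 => // /eqP; rewrite (negPf x20).
  rewrite /X /Y y10 y20 !mulr0 addr0 eqxx subr0 sgzM intrM sgz0 /=.
  (* Both factors are real at the endpoint, so [Y] vanishes there; its inner sign is obtained from
     its two summands. *)
  have := sgz_add_carry (x1' * y2') (x2' * y1'); rewrite -/Y' !sgzM !intrM -sx1 -sx2 => {1}->.
  have := sg_sqr x10; have := sg_sqr x20.
  move: (sg x1) (sg x2) (sg y1') (sg y2') (sg Y') => p q r s t hq hp.
  transitivity ((p * p) * s * q + (q * q) * r * p - (p * p) * (q * q) * r * s * t); first by ring.
  by rewrite hp hq; ring.
- have x10 := co1 y10.
  have sy2 : sgz y2 = sgz y2' by case: ey2 => // /eqP; rewrite (negPf y20).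
  have YE : Y = x1 * y2 by rewrite /Y y10 mulr0 addr0.
  have Y0 : Y != 0 by rewrite YE mulf_neq0.
  have sY : sgz Y = sgz Y' by case: eY => // /eqP; rewrite (negPf Y0).
  rewrite (negPf Y0) -sY -sy2 y10 sgz0 YE sgzM intrM.
  have := sg_sqr y20; move: (sg x1) (sg y2) (sg y1') => p q r hq.
  transitivity (r * p - r * (q * q) * p); first by rewrite /= hq; ring.
  by rewrite /=; ring.
- have x20 := co2 y20.
  have sy1 : sgz y1 = sgz y1' by case: ey1 => // /eqP; rewrite (negPf y10).
  have YE : Y = x2 * y1 by rewrite /Y y20 mulr0 add0r.
  have Y0 : Y != 0 by rewrite YE mulf_neq0.
  have sY : sgz Y = sgz Y' by case: eY => // /eqP; rewrite (negPf Y0).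
  rewrite (negPf Y0) -sY -sy1 y20 sgz0 YE sgzM intrM.
  have := sg_sqr y10; move: (sg x2) (sg y1) (sg y2') => p q r hq.
  transitivity (r * p - r * (q * q) * p); first by rewrite /= hq; ring.
  by rewrite /=; ring.
have sy1 : sgz y1 = sgz y1' by case: ey1 => // /eqP; rewrite (negPf y10).
have sy2 : sgz y2 = sgz y2' by case: ey2 => // /eqP; rewrite (negPf y20).
have [Y0|Y0] := eqVneq Y 0; last first.
  have sY : sgz Y = sgz Y' by case: eY => // /eqP; rewrite (negPf Y0).
  by rewrite -sy1 -sy2 -sY /=; ring.
(* Here the product is real and the factors are not: [Y = 0] makes the first factor a real multiple
   of the conjugate of the second, which fixes the sign of [X]. *)
suff -> : sgz X = - (sgz y1 * sgz y2).
  by rewrite -sy1 -sy2 Y0 sgz0 rmorphN/= intrM; ring.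
have pos : 0 < x2 ^+ 2 + y2 ^+ 2.
  by rewrite ltr_wpDl ?sqr_ge0// lt_def sqr_ge0 expf_eq0 y20.
have pos2 : 0 < y2 ^+ 2 by rewrite lt_def sqr_ge0 expf_eq0 y20.
have : X * y2 ^+ 2 = - (y1 * y2 * (x2 ^+ 2 + y2 ^+ 2)).
  have xy : x1 * y2 = - (x2 * y1) by apply/eqP; rewrite -addr_eq0; apply/eqP.
  rewrite /X; transitivity ((x1 * y2) * x2 * y2 - y1 * y2 * y2 ^+ 2); first by ring.
  by rewrite xy; ring.
move/(congr1 (@sgz R)).
by rewrite sgzN (sgzM X) (gtr0_sgz pos2) (sgzM (y1 * y2)) (gtr0_sgz pos) (sgzM y1) !mulr1.
Qed.

(* c is the carry when the arguments of the two factors are added modulo pi. *)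
Lemma idx_product a b (x1 y1 x2 y2 : {poly R}) (X := x1 * x2 - y1 * y2) (Y := x1 * y2 + x2 * y1)
    (c := fun t => sg (y1.[t] * y2.[t] * Y.[t])) : a < b ->
  coprime_on a b x1 y1 -> coprime_on a b x2 y2 ->
  2 * idx a b X Y = 2 * idx a b x1 y1 + 2 * idx a b x2 y2 - c b + c a.
Proof.
move=> ab c1 c2.
have XE t : X.[t] = x1.[t] * x2.[t] - y1.[t] * y2.[t] by rewrite !hornerE.
have YE t : Y.[t] = x1.[t] * y2.[t] + x2.[t] * y1.[t] by rewrite !hornerE.
have c3 : coprime_on a b X Y.
  move=> t tab; have := coprime_onC c1 tab; have := coprime_onC c2 tab.
  have := c1 t tab; have := c2 t tab; rewrite XE YE.
  move: x1.[t] y1.[t] x2.[t] y2.[t] => {XE YE c1 c2 tab} p q r s.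
  move=> h1 h2 h3 h4 e; apply/eqP => e2.
  (* The norm is multiplicative, so a common zero of [X] and [Y] makes the norm of one factor
     vanish, against coprimality. *)
  have n0 : (p ^+ 2 + q ^+ 2) * (r ^+ 2 + s ^+ 2) = 0.
    have -> : (p ^+ 2 + q ^+ 2) * (r ^+ 2 + s ^+ 2) = (p * r - q * s) ^+ 2 + (p * s + r * q) ^+ 2 by ring.
    by rewrite e e2 expr0n addr0.
  move/eqP: n0; rewrite mulf_eq0 => /orP[] /eqP n0.
  - have /eqP : p ^+ 2 = 0 by have := sqr_ge0 p; have := sqr_ge0 q; lra.
    have /eqP : q ^+ 2 = 0 by have := sqr_ge0 p; have := sqr_ge0 q; lra.
    rewrite !expf_eq0/= => /eqP /h2 /negPf -> //.
  - have /eqP : r ^+ 2 = 0 by have := sqr_ge0 r; have := sqr_ge0 s; lra.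
    have /eqP : s ^+ 2 = 0 by have := sqr_ge0 r; have := sqr_ge0 s; lra.
    rewrite !expf_eq0/= => /eqP /h1 /negPf -> //.
pattern a, b; apply: (split_ind_in (ps := [:: x1; y1; x2; y2; Y]) ab) => [u v w _ uv vw _ e1 e2|u v m au umv vb nr].
  by rewrite !(idx_split _ _ uv vw); lra.
have /andP[um mv] := umv; have uv := ltW (lt_trans um mv).
have nr1 : forall i, (i < 5)%N -> let p := [:: x1; y1; x2; y2; Y]`_i in p = 0 \/ forall x, u < x < v -> p.[x] != 0.
  by move=> i i5; apply: nr; apply: mem_nth.
rewrite (idx_cell (coprime_on_sub au vb c1) umv (nr1 1%N isT)).
rewrite (idx_cell (coprime_on_sub au vb c2) umv (nr1 3%N isT)).
rewrite (idx_cell (coprime_on_sub au vb c3) umv (nr1 4%N isT)).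
have H t : u <= t <= v -> sg Y.[m] * ((Y.[t] == 0)%:R * sg X.[t]) =
    sg y1.[m] * ((y1.[t] == 0)%:R * sg x1.[t]) +
    sg y2.[m] * ((y2.[t] == 0)%:R * sg x2.[t]) - c m + c t.
  move=> tuv; have tab : a <= t <= b.
    by move: tuv => /andP[ut tv]; rewrite (le_trans au ut) (le_trans tv vb).
  have ex1 := sgz_end (nr1 0%N isT) umv tuv; have ey1 := sgz_end (nr1 1%N isT) umv tuv.
  have ex2 := sgz_end (nr1 2%N isT) umv tuv; have ey2 := sgz_end (nr1 3%N isT) umv tuv.
  have eY := sgz_end (nr1 4%N isT) umv tuv.
  rewrite /c /= !YE XE; apply: product_end => //.
  - by move: eY; rewrite /= !YE.
  - exact: c1.
  - exact: c2.
have := H u; have := H v; rewrite !lexx uv => /(_ isT) hv /(_ isT) hu.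
rewrite !mulrBr; lra.
Qed.

End Formulas.

(** * Sturm's algorithm *)

Section SturmCorrect.
Variable R : realFieldType.
Hypothesis rcR : real_closed R.
Implicit Types (a b x m : R) (P Q U V : {poly R}).

Local Notation sg x := ((sgz x)%:~R : rat).

Lemma sturm_rec_cons fuel P Q : exists s, sturm_rec fuel P Q = P :: s.
Proof. by case: fuel => [|n] /=; [exists [::]|eexists]. Qed.

Lemma gcdp_modN P Q : gcdp Q (- (P %% Q)) %= gcdp P Q.
Proof.
have e : - (P %% Q) %= P %% Q by rewrite -scaleN1r eqp_scale// oppr_eq0 oner_eq0.
apply: eqp_trans (eqp_gcdr Q e) _.
by apply: eqp_trans (gcdp_modr _ _) _; apply: gcdpC.
Qed.

(** Sizes decrease strictly from [Q] on, so this fuel lets the recursion run down to a zero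
    remainder. *)
Lemma last_sturm_rec fuel P Q : (size Q <= fuel)%N ->
  last 0 (sturm_rec fuel P Q) %= gcdp P Q.
Proof.
elim: fuel P Q => [|n IH] P Q /=.
  by rewrite size_poly_leq0 => /eqP->; rewrite gcdp0 eqpxx.
have [->|Q0] := eqVneq Q 0; first by rewrite gcdp0 eqpxx.
move=> sQ; have [s sE] := sturm_rec_cons n Q (- (P %% Q)).
have sR : (size (- (P %% Q)) <= n)%N.
  by rewrite size_polyN -ltnS (leq_trans _ sQ)// ltn_modp.
have := IH Q _ sR; rewrite sE /= => /eqp_trans; apply.
exact: gcdp_modN.
Qed.

Lemma sign_variation_cons a P Q s : sign_variation a [:: P, Q & s] =
  2^-1 * `|sg P.[a] - sg Q.[a]| + sign_variation a (Q :: s).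
Proof.
rewrite /sign_variation /= big_nat_recl//=; congr (_ + _).
by rewrite !big_add1 /=; apply: eq_bigr.
Qed.

Lemma sign_variation1 a P : sign_variation a [:: P] = 0.
Proof. by rewrite /sign_variation big_geq. Qed.

(** Turns a sign variation into the sign of a product, the quantity that occurs in the reciprocity
    formula. *)
Lemma abs_sg_sub (x y : R) : (x = 0 -> y != 0) ->
  `|sg x - sg y| = 1 - sg (y * x).
Proof.
rewrite sgzM intrM.
case: (sgzP x) => [-> /(_ erefl)|x0 _|x0 _]; case: (sgzP y) => // *.
Qed.

(** The first variation is the right side of reciprocity for [S1 / S0]; the swapped index becomes
    minus that of [S2 / S1] because [S0] is congruent to [- S2] modulo [S1], and induction treats
    the rest. One gcd [g] serves the whole chain, and dividing by it leaves indices unchanged and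
    makes neighbours coprime. *)
Lemma idx_sturm_rec a b g fuel P Q : a < b -> P != 0 -> g %= gcdp P Q ->
  (size Q <= fuel)%N ->
  let s := [seq F %/ g | F <- sturm_rec fuel P Q] in
  sign_variation a s - sign_variation b s = idx a b Q P.
Proof.
move=> ab; elim: fuel P Q => [|n IH] P Q P0 gE /=.
  rewrite size_poly_leq0 => /eqP->.
  by rewrite !sign_variation1 subrr /idx ratfun0l Ind0.
have [->|Q0] := eqVneq Q 0.
  by rewrite /= !sign_variation1 subrr /idx ratfun0l Ind0.
move=> sQ; set T := - (P %% Q).
have g0 : g != 0.
  by apply: contraNneq P0 => g0; move: gE; rewrite g0 eqp_sym eqp0 gcdp_eq0 => /andP[].
have sT : (size T <= n)%N.
  by rewrite size_polyN -ltnS (leq_trans _ sQ)// ltn_modp.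
have gE' : g %= gcdp Q T.
  by rewrite (eqp_trans gE)// eqp_sym gcdp_modN.
have gP : g %| P by rewrite (eqp_dvdl _ gE) dvdp_gcdl.
have gQ : g %| Q by rewrite (eqp_dvdl _ gE) dvdp_gcdr.
have gT : g %| T by rewrite (eqp_dvdl _ gE') dvdp_gcdr.
have := IH Q T Q0 gE' sT; have [s ->] := sturm_rec_cons n Q T.
rewrite /= !sign_variation_cons.
set S0 := P %/ g; set S1 := Q %/ g; pose S2 := T %/ g.
have PE : P = S0 * g by rewrite divpK.
have QE : Q = S1 * g by rewrite divpK.
have TE : T = S2 * g by rewrite divpK.
have -> : idx a b T Q = idx a b S2 S1 by rewrite {1}TE {1}QE /idx ratfunMr.
have -> : idx a b Q P = idx a b S1 S0 by rewrite {1}PE {1}QE /idx ratfunMr.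
have S012 : S0 = (P %/ Q) * S1 - S2.
  apply: (mulIf g0); rewrite mulrBl -mulrA -PE -QE -TE /T opprK.
  exact: divp_eq.
(* A common root [x] would make [('X - x%:P) * g] a common divisor larger than the gcd. *)
have co : coprime_on a b S1 S0.
  move=> x _ S0x; apply/eqP => S1x.
  have : ('X - x%:P) * g %| gcdp P Q.
    by rewrite dvdp_gcd [X in _ %| X]PE [X in _ && (_ %| X)]QE !dvdp_mul2r// !dvdp_XsubCl /root S0x S1x eqxx.
  rewrite -(eqp_dvdr _ gE) => /(dvdp_leq g0).
  by rewrite size_monicM ?monicXsubC// size_XsubC ltnn.
have e1 := idx_reciprocity rcR ab co.
have e2 : idx a b S0 S1 = - idx a b S2 S1.
  apply: (idx_congr rcR ab) => x xab S1x; split; first exact: (coprime_onC co).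
  by rewrite {1}S012 !hornerE S1x mulr0 sub0r sgzN.
have H x : a <= x <= b -> `|sg S0.[x] - sg S1.[x]| = 1 - sg (S1.[x] * S0.[x]).
  by move=> xab; apply: abs_sg_sub; apply: co.
rewrite (H a) ?lexx ?ltW// (H b) ?lexx ?ltW//; lra.
Qed.

Lemma sturmE a b U V : a < b -> sturm U V a b = idx a b U V.
Proof.
move=> ab; rewrite /sturm; case: ifPn => [/orP[]/eqP->|].
- by rewrite /idx ratfun0l Ind0.
- by rewrite /idx ratfun0r Ind0.
rewrite negb_or => /andP[U0 V0]; apply: idx_sturm_rec => //.
exact: last_sturm_rec.
Qed.

End SturmCorrect.

(** * Presentations of piecewise polynomial maps *)

Section Presentations.
Variable R : realFieldType.
Implicit Types (a b x : R) (P Q : {poly R[i]}) (g h : itv01 R -> R[i]).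

Definition mk01 x (x01 : 0 <= x <= 1) : itv01 R := exist _ x x01.

Lemma coef_poly_re P i : (poly_re P)`_i = complex.Re P`_i.
Proof. by rewrite coef_map_id0. Qed.

Lemma coef_poly_im P i : (poly_im P)`_i = complex.Im P`_i.
Proof. by rewrite coef_map_id0. Qed.

Lemma poly_reimE P : P = map_poly (real_complex R) (poly_re P)
  + (0 +i* 1 : R[i])%:P * map_poly (real_complex R) (poly_im P).
Proof.
apply/polyP => i; rewrite coefD coefCM !coef_map coef_poly_re coef_poly_im.
by case: P`_i => u v; apply/eqP; rewrite eq_complex /= !(mul0r, mul1r, mulr0, addr0, add0r, subr0) !eqxx.
Qed.

Lemma horner_reim P x : P.[x%:C] = (poly_re P).[x] +i* (poly_im P).[x].
Proof.
rewrite {1}[P]poly_reimE hornerD hornerM hornerC !horner_map /=.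
by apply/eqP; rewrite eq_complex /= !(mul0r, mul1r, mulr0, addr0, add0r, subr0) !eqxx.
Qed.

Lemma eq_poly_itv a b P Q : a < b ->
  (forall x, a <= x <= b -> P.[x%:C] = Q.[x%:C]) -> P = Q.
Proof.
move=> ab PQ; apply/eqP; rewrite -subr_eq0; apply/eqP.
(* As many distinct points of the interval as the size of [P - Q], which is more than its degree
   allows as roots. *)
pose s := [seq (a + (b - a) / k.+1%:R)%:C | k <- iota 0 (size (P - Q))].
apply: (@roots_geq_poly_eq0 _ _ s).
- apply/allP => _ /mapP[k _ ->]; rewrite /root !hornerE PQ ?subrr//.
  have k0 : (0 : R) < k.+1%:R by rewrite ltr0n.
  have ba : 0 <= b - a by rewrite subr_ge0 ltW.
  rewrite lerDl divr_ge0 ?(ltW k0)//= -lerBrDl ler_pdivrMr//.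
  by rewrite ler_peMr// ler1n.
- rewrite map_inj_uniq ?iota_uniq// => j k [] /addrI.
  move=> /(mulfI _); rewrite subr_eq0 gt_eqF// => /(_ isT)/invr_inj/eqP.
  by rewrite eqr_nat eqSS => /eqP.
- by rewrite size_map size_iota.
Qed.

Lemma subdivision_in01 n (t : nat -> R) k : subdivision n t -> (k <= n)%N -> 0 <= t k <= 1.
Proof.
move=> tS kn; have [h0 h1 _] := tS.
by rewrite -{1}h0 -h1 !(subdivision_le tS) ?kn ?leqnn ?leq0n.
Qed.

Lemma presents_sub01 n (t : nat -> R) k x : subdivision n t -> (k < n)%N ->
  t k <= x <= t k.+1 -> 0 <= x <= 1.
Proof.
move=> tS kn /andP[tx xt].
have /andP[t0 _] := subdivision_in01 tS (ltnW kn).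
have /andP[_ t1] := subdivision_in01 tS kn.
by rewrite (le_trans t0 tx) (le_trans xt t1).
Qed.

Section RefineSum.
Variables (I : nat -> R -> R -> rat).
Hypothesis Icat : forall k a b c, a < b -> b < c -> I k a c = I k a b + I k b c.

Let I' k a b : rat := if a < b then I k a b else 0.

Lemma refine_sum n (t : nat -> R) l (r : nat -> R) (c : nat -> nat) :
  subdivision n t -> subdivision l r ->
  (forall j, (j < l)%N -> [/\ (c j < n)%N, t (c j) <= r j & r j.+1 <= t (c j).+1]) ->
  \sum_(k < n) I k (t k) (t k.+1) = \sum_(j < l) I (c j) (r j) (r j.+1).
Proof.
move=> tS rS cP; have [t0 t1 tlt] := tS; have [r0 r1 rlt] := rS.
(* [F x] is the sum over the part of [[0, x]]: cells are clipped at [x], and [I'] counts the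
   degenerate ones as 0. The fine sum is the telescoping sum of the increments of [F]. *)
pose F x := \sum_(k < n) I' k (Num.min x (t k)) (Num.min x (t k.+1)).
have step j : (j < l)%N -> F (r j.+1) - F (r j) = I (c j) (r j) (r j.+1).
  move=> jl; have [cn tr rt] := cP j jl; have rr := rlt j jl.
  rewrite /F -sumrB (bigD1 (Ordinal cn)) //= [X in _ + X]big1 ?addr0; last first.
    move=> [k kn] /=; rewrite -val_eqE /= neq_ltn => /orP[kc|ck].
      have tk : t k.+1 <= r j.
        by apply: le_trans tr; apply: (subdivision_le tS); rewrite kc ltnW.
      have tk' : t k <= r j := le_trans (ltW (tlt _ kn)) tk.
      rewrite !min_r ?subrr//.
        exact: le_trans tk (ltW rr).
      exact: le_trans tk' (ltW rr).
    have tk : r j.+1 <= t k.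
      by apply: le_trans rt _; apply: (subdivision_le tS); rewrite ck ltnW.
    have tk' : r j.+1 <= t k.+1 := le_trans tk (ltW (tlt _ kn)).
    rewrite !min_l ?(le_trans _ tk) ?(le_trans _ tk') ?(ltW rr)//.
    by rewrite /I' !ltxx subrr.
  rewrite (min_r (y := t (c j))) ?(le_trans tr (ltW rr))//.
  rewrite (min_l (y := t (c j).+1))// (min_r tr) (min_l (le_trans (ltW rr) rt)).
  rewrite /I' (le_lt_trans tr rr); move: tr; rewrite le_eqVlt => /orP[/eqP->|tr].
    by rewrite ltxx subr0.
  by rewrite tr (Icat _ tr rr) addrAC subrr add0r.
have F0 : F (r 0%N) = 0.
  rewrite /F big1// => [[k kn] _] /=; rewrite r0 !min_l ?/I' ?ltxx//.
    by have /andP[] := subdivision_in01 tS kn.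
  by have /andP[] := subdivision_in01 tS (ltnW kn).
have F1 : F (r l) = \sum_(k < n) I k (t k) (t k.+1).
  rewrite /F; apply: eq_bigr => -[k kn] _ /=; rewrite r1 !min_r ?/I' ?tlt//.
    by have /andP[] := subdivision_in01 tS kn.
  by have /andP[] := subdivision_in01 tS (ltnW kn).
have tel := telescope_sumr (fun j => F (r j)) (leq0n l).
rewrite -F1 -[LHS]subr0 -[X in _ - X]F0 -tel.
by rewrite big_mkord; apply: eq_bigr => -[j jl] _; rewrite step.
Qed.

End RefineSum.

Lemma common_refinement n (t : nat -> R) m (s : nat -> R) :
  subdivision n t -> subdivision m s ->
  exists l r (c d : nat -> nat), [/\ subdivision l r,
    forall j, (j < l)%N -> [/\ (c j < n)%N, t (c j) <= r j & r j.+1 <= t (c j).+1] &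
    forall j, (j < l)%N -> [/\ (d j < m)%N, s (d j) <= r j & r j.+1 <= s (d j).+1]].
Proof.
move=> tS sS; have [l [r [rS rP]]] := subdivision_refine tS sS.
have ex (p : nat) (q : nat -> R) : (forall j, (j < l)%N ->
    exists2 k, (k < p)%N & q k <= r j /\ r j.+1 <= q k.+1) ->
  exists c : nat -> nat, forall j, (j < l)%N ->
    [/\ (c j < p)%N, q (c j) <= r j & r j.+1 <= q (c j).+1].
  move=> H; have [|c cP] := @choice _ _ (fun j k => (j < l)%N ->
      [/\ (k < p)%N, q k <= r j & r j.+1 <= q k.+1]); last by exists c.
  move=> j; have [/H[k kn [k1 k2]]|_] := ltnP j l; last by exists 0%N.
  by exists k.
have [c cP] := ex n t (fun j jl => (rP j jl).1).
have [d dP] := ex m s (fun j jl => (rP j jl).2).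
by exists l, r, c, d.
Qed.

Lemma presents_refine g n t (P : nat -> {poly R[i]}) l r (c : nat -> nat) :
  presents g n t P -> subdivision l r ->
  (forall j, (j < l)%N -> [/\ (c j < n)%N, t (c j) <= r j & r j.+1 <= t (c j).+1]) ->
  presents g l r (P \o c).
Proof.
move=> [tS gP] rS cP; split=> // j jl x /andP[rx xr].
have [cn tr rt] := cP j jl.
by rewrite /= -gP// (le_trans tr rx) (le_trans xr rt).
Qed.

Definition cindex_cell a b P : rat := idx a b (poly_re P) (poly_im P).

Lemma half_cauchy_indexE n t (P : nat -> {poly R[i]}) :
  half_cauchy_index n t P = 2^-1 * \sum_(k < n) cindex_cell (t k) (t k.+1) (P k).
Proof. by []. Qed.

Lemma presents_uniq g n t (P Q : nat -> {poly R[i]}) k : presents g n t P -> presents g n t Q ->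
  (k < n)%N -> P k = Q k.
Proof.
move=> [tS gP] [_ gQ] kn; have [_ _ tlt] := tS.
apply: (eq_poly_itv (tlt k kn)) => x xk.
have x01 := presents_sub01 tS kn xk.
by rewrite -(gP k kn (mk01 x01) xk) -(gQ k kn (mk01 x01) xk).
Qed.

Lemma half_cauchy_index_refine n t (P : nat -> {poly R[i]}) l (r : nat -> R) (c : nat -> nat) :
  subdivision n t -> subdivision l r ->
  (forall j, (j < l)%N -> [/\ (c j < n)%N, t (c j) <= r j & r j.+1 <= t (c j).+1]) ->
  half_cauchy_index n t P = half_cauchy_index l r (P \o c).
Proof.
move=> tS rS cP; rewrite !half_cauchy_indexE; congr (_ * _).
apply: (refine_sum (I := fun k a b => cindex_cell a b (P k))) => // k u v w uv vw.
exact: idx_split.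
Qed.

(** Refining does not change the sum, and on a common refinement both presentations consist of the
    same polynomials, since these agree on whole intervals. *)
Lemma half_cauchy_index_uniq g n t (P : nat -> {poly R[i]}) n' t' (P' : nat -> {poly R[i]}) :
  presents g n t P -> presents g n' t' P' ->
  half_cauchy_index n t P = half_cauchy_index n' t' P'.
Proof.
move=> pP pP'; have [tS _] := pP; have [tS' _] := pP'.
have [l [r [c [d [rS cP dP]]]]] := common_refinement tS tS'.
rewrite (half_cauchy_index_refine _ tS rS cP) (half_cauchy_index_refine _ tS' rS dP).
rewrite !half_cauchy_indexE; congr (_ * _); apply: eq_bigr => -[k kl] _ /=.
have pc := presents_refine pP rS cP; have pd := presents_refine pP' rS dP.
by rewrite -[P (c k)]/((P \o c) k) (presents_uniq pc pd kl).
Qed.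

Lemma common_presentation g h : piecewise_poly g -> piecewise_poly h ->
  exists n t (P Q : nat -> {poly R[i]}), presents g n t P /\ presents h n t Q.
Proof.
move=> [n [t [P pP]]] [m [s [Q pQ]]]; have [tS _] := pP; have [sS _] := pQ.
have [l [r [c [d [rS cP dP]]]]] := common_refinement tS sS.
exists l, r, (P \o c), (Q \o d); split.
  exact: presents_refine cP.
exact: presents_refine dP.
Qed.

End Presentations.

(** * Index along the boundary of a rectangle *)

Section Rectangles.
Variable R : realFieldType.
Hypothesis rcR : real_closed R.
Implicit Types (a b c d s t x : R) (p g : {poly R}) (U V G W : {poly {poly R}}).

Local Notation sg x := ((sgz x)%:~R : rat).

Lemma real_closed_axiomP : Num.real_closed_axiom R.
Proof.
move=> p a b ab /andP[pa pb].
have [/eqP ra|ra] := eqVneq p.[a] 0; first by exists a; rewrite ?lexx.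
have [/eqP rb|rb] := eqVneq p.[b] 0; first by exists b; rewrite ?lexx ?ab.
have ab' : a < b.
  rewrite lt_neqAle ab andbT; apply: contraNneq ra => e.
  by rewrite eq_le pa e pb.
have [|x /andP[ax xb] px] := rcR (P := p) ab'.
  by rewrite nmulr_rlt0 lt_def ?rb ?pb// eq_sym ra.
by exists x; rewrite ?(ltW ax) ?(ltW xb)//; apply/eqP.
Qed.

Lemma real_closed_mvt p a b : a < b ->
  exists2 c, a < c < b & p.[b] - p.[a] = p^`().[c] * (b - a).
Proof.
move=> ab.
(* The field is packed as a real closed field structure in order to borrow the mean value theorem
   for polynomials. *)
pose K : rcfType := HB.pack (Num.RealField.sort R)
  (Num.RealField_isClosed.Build R real_closed_axiomP).
have [c cab e] := @poly_mvt K a b p ab.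
by exists c => //; move: cab; rewrite in_itv.
Qed.

(** Between consecutive roots of its derivative [g] is monotone, so there [|g|] is at least the
    smaller of its two endpoint values; finitely many pieces give a positive minimum. *)
Lemma noroot_lower_bound g c d : c < d -> (forall x, c <= x <= d -> g.[x] != 0) ->
  exists2 m, 0 < m & forall x, c <= x <= d -> m <= `|g.[x]|.
Proof.
move=> cd nr; pattern c, d.
apply: (split_ind_in (ps := [:: g^`()]) cd) => [u v w cu uv vw wd [m1 m10 H1] [m2 m20 H2]|u v m cu /andP[um mv] vd nr'].
  exists (Num.min m1 m2); first by rewrite lt_min m10.
  move=> x /andP[ux xw]; rewrite ge_min.
  have [xv|vx] := leP x v; first by rewrite H1// ux.
  by rewrite H2 ?orbT// xw ltW.
have uv := lt_trans um mv.
have ucd : c <= u <= d by rewrite cu (le_trans (ltW uv)).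
have vcd : c <= v <= d by rewrite vd (le_trans cu (ltW uv)).
exists (Num.min `|g.[u]| `|g.[v]|); first by rewrite lt_min !normr_gt0 !nr.
move=> x /andP[ux xv]; rewrite ge_min.
have xcd : c <= x <= d by rewrite (le_trans cu ux) (le_trans xv vd).
move: ux; rewrite le_eqVlt => /predU1P[->|ux]; first by rewrite lexx.
move: xv; rewrite le_eqVlt => /predU1P[->|xv]; first by rewrite lexx orbT.
have [y1 /andP[uy1 y1x] e1] := real_closed_mvt g ux.
have [y2 /andP[xy2 y2v] e2] := real_closed_mvt g xv.
have same : sgz g^`().[y1] = sgz g^`().[y2].
  have [->|nr1] := nr' _ (mem_head _ _); first by rewrite !horner0.
  by apply: (sgz_noroot rcR nr1); rewrite ?uy1 ?y2v ?(lt_trans y1x xv) ?(lt_trans ux xy2).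
have pos y z : y < z -> c <= y -> z <= d -> 0 < g.[y] * g.[z].
  move=> yz cy zd; rewrite lt_def mulf_neq0 ?nr ?(le_trans cy (ltW yz)) ?(le_trans (ltW yz) zd) ?cy ?zd//=.
  rewrite leNgt; apply/negP => /(rcR yz)[r /andP[yr rz] gr].
  by have := nr r; rewrite gr eqxx (le_trans cy (ltW yr)) (le_trans (ltW rz) zd) => /(_ isT).
have := pos u x ux cu; have := pos x v xv _ vd.
move: xcd vcd ucd => /andP[-> ->] _ _ /(_ isT) h2 /(_ isT) h1.
have x1 : 0 < x - u by rewrite subr_gt0.
have x2 : 0 < v - x by rewrite subr_gt0.
have gx0 : g.[x] != 0 by apply: contraTneq h1 => ->; rewrite mulr0 ltxx.
have H : (g.[u] <= g.[x] <= g.[v]) || (g.[v] <= g.[x] <= g.[u]).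
  have : sgz (g.[x] - g.[u]) = sgz (g.[v] - g.[x]).
    by rewrite e1 e2 !sgzM same !(gtr0_sgz (x := _ - _)).
  case: (sgzP (g.[x] - g.[u])) => h3; case: (sgzP (g.[v] - g.[x])) => h4 // _;
    apply/orP; [left|left|right]; apply/andP; split; lra.
move: gx0; rewrite neq_lt => /orP[gx|gx].
  move: h1 h2; rewrite nmulr_lgt0// nmulr_rgt0// => gu gv.
  by rewrite !ltr0_norm// !lerN2; case/orP: H => /andP[h3 h4]; rewrite ?h3 ?h4 ?orbT.
move: h1 h2; rewrite pmulr_lgt0// pmulr_rgt0// => gu gv.
by rewrite !gtr0_norm//; case/orP: H => /andP[h3 h4]; rewrite ?h3 ?h4 ?orbT.
Qed.

Lemma poly_upper_bound p B : exists2 K : R, 0 <= K &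
  forall t, `|t| <= B -> `|p.[t]| <= K.
Proof.
elim/poly_ind: p => [|p c [K K0 H]].
  by exists 0 => // t _; rewrite horner0 normr0.
exists (K * `|B| + `|c|); first by rewrite addr_ge0// mulr_ge0.
move=> t tB; rewrite hornerMXaddC (le_trans (ler_normD _ _))// lerD2r normrM.
by rewrite ler_pM ?H// (le_trans tB)// ler_norm.
Qed.

Lemma poly2_upper_bound W B1 B2 : exists2 K : R, 0 <= K &
  forall s t, `|s| <= B1 -> `|t| <= B2 -> `|W.[s%:P].[t]| <= K.
Proof.
elim/poly_ind: W => [|W c [K K0 H]].
  by exists 0 => // s t _ _; rewrite !horner0 normr0.
have [L L0 HL] := poly_upper_bound c B2.
exists (K * `|B1| + L); first by rewrite addr_ge0// mulr_ge0.
move=> s t sB tB; rewrite hornerMXaddC hornerD hornerM hornerC.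
rewrite (le_trans (ler_normD _ _))// lerD ?HL// normrM.
by rewrite ler_pM ?H// (le_trans sB)// ler_norm.
Qed.

(** [G] differs from its restriction to [s0] by [(s - s0)] times a polynomial [W]. The restriction
    is bounded away from 0 and [W] is bounded above, so a uniform neighbourhood exists without
    compactness. *)
Lemma noroot_near G s0 c d : c < d ->
  (forall t, c <= t <= d -> G.[s0%:P].[t] != 0) ->
  exists2 e, 0 < e & forall s t, `|s - s0| <= e -> c <= t <= d ->
    G.[s%:P].[t] != 0.
Proof.
move=> cd nr; have [m m0 mP] := noroot_lower_bound cd nr.
have /factor_theorem[W WE] : root (G - G.[s0%:P]%:P) s0%:P.
  by rewrite /root !hornerE subrr.
have [K K0 KP] := poly2_upper_bound W (`|s0| + 1) (`|c| + `|d|).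
have K1 : 0 < 2 * (K + 1) by lra.
(* The bound 1 keeps [s] where [K] bounds [W]; the other one makes [K * e] smaller than [m], with
   [K + 1] in place of [K] because [K] may be 0. *)
exists (Num.min 1 (m / (2 * (K + 1)))); first by rewrite lt_min ltr01 divr_gt0.
move=> s t; rewrite le_min => /andP[s1 sm] tcd.
have e : G.[s%:P].[t] = G.[s0%:P].[t] + W.[s%:P].[t] * (s - s0).
  have /(congr1 (fun q : {poly {poly R}} => q.[s%:P].[t])) := WE.
  by rewrite !hornerE /= => <-; ring.
have Wb : `|W.[s%:P].[t]| <= K.
  apply: KP.
    have := ler_normD s0 (s - s0); rewrite addrC subrK => /le_trans; apply.
    by rewrite lerD2l.
  move: tcd => /andP[ct td]; have := ler_norm d; have := ler_norm (- c).
  rewrite normrN => h1 h2; rewrite ler_norml.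
  by have := normr_ge0 c; have := normr_ge0 d; lra.
apply/eqP => G0; have := mP t tcd.
have -> : G.[s0%:P].[t] = - (W.[s%:P].[t] * (s - s0)) by lra.
rewrite normrN normrM leNgt => /negP; apply.
have : `|W.[s%:P].[t]| * `|s - s0| <= K * (m / (2 * (K + 1))) by rewrite ler_pM.
move/le_lt_trans; apply; rewrite mulrA ltr_pdivrMr//.
have := mulr_ge0 K0 (ltW m0); lra.
Qed.

(* The boundary of [a, b] x [c, d] is oriented counterclockwise. *)
Definition boundary_index U V a b c d : rat :=
  idx c d U.[b%:P] V.[b%:P] - idx c d U.[a%:P] V.[a%:P]
  - (idx a b (swapXY U).[d%:P] (swapXY V).[d%:P]
     - idx a b (swapXY U).[c%:P] (swapXY V).[c%:P]).

Lemma horner_swap G s t : (swapXY G).[t%:P].[s] = G.[s%:P].[t].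
Proof. exact: horner2_swapXY. Qed.

Lemma boundary_index_horiz U V a b e c d : a < b -> b < e ->
  boundary_index U V a e c d = boundary_index U V a b c d + boundary_index U V b e c d.
Proof.
move=> ab be; rewrite /boundary_index (idx_split _ _ ab be) (idx_split _ _ ab be); ring.
Qed.

Lemma boundary_index_vert U V a b c d e : c < d -> d < e ->
  boundary_index U V a b c e = boundary_index U V a b c d + boundary_index U V a b d e.
Proof.
move=> cd de; rewrite /boundary_index (idx_split _ _ cd de) (idx_split _ _ cd de); ring.
Qed.

(** If [V] has no zero, no side has a pole. If [U] has none, each side contributes a difference of
    signs at its corners, and these cancel around the rectangle. *)
Lemma boundary_index_noroot U V a b c d : a < b -> c < d ->
  (forall s t, a <= s <= b -> c <= t <= d -> V.[s%:P].[t] != 0) \/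
  (forall s t, a <= s <= b -> c <= t <= d -> U.[s%:P].[t] != 0) ->
  boundary_index U V a b c d = 0.
Proof.
move=> ab cd; rewrite /boundary_index => -[] nr.
  rewrite !(idx_noroot rcR) ?subrr// => x xab; rewrite ?horner_swap.
  - by apply: nr; rewrite // lexx ltW.
  - by apply: nr; rewrite // lexx ltW.
  - by apply: nr; rewrite // lexx ltW.
  - by apply: nr; rewrite // lexx ltW.
have E1 s : a <= s <= b -> 2 * idx c d U.[s%:P] V.[s%:P] =
    sg (U.[s%:P].[d] * V.[s%:P].[d]) - sg (U.[s%:P].[c] * V.[s%:P].[c]).
  by move=> sab; apply: (idx_num_noroot rcR) => // t; apply: nr.
have E' t : c <= t <= d -> 2 * idx a b (swapXY U).[t%:P] (swapXY V).[t%:P] =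
    sg (U.[b%:P].[t] * V.[b%:P].[t]) - sg (U.[a%:P].[t] * V.[a%:P].[t]).
  move=> tcd; rewrite (idx_num_noroot rcR _ ab) ?horner_swap// => s sab.
  by rewrite horner_swap nr.
have := E1 b; have := E1 a; have := E' c; have := E' d.
rewrite !lexx !ltW// => /(_ isT) h1 /(_ isT) h2 /(_ isT) h3 /(_ isT) h4; lra.
Qed.

(** The segment [s = s0] is cut into pieces with at most one end [x] where [U] or [V] may vanish.
    One of the two is nonzero at [x], hence on the whole piece, and by [noroot_near] on a strip
    around it. *)
Lemma boundary_index_near U V s0 c d : c < d ->
  (forall t, c <= t <= d -> V.[s0%:P].[t] = 0 -> U.[s0%:P].[t] != 0) ->
  exists2 e, 0 < e & forall a b, a < b -> `|a - s0| <= e -> `|b - s0| <= e ->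
    boundary_index U V a b c d = 0.
Proof.
move=> cd co; pattern c, d.
apply: (split_ind_in (ps := [:: U.[s0%:P]; V.[s0%:P]]) cd) =>
    [u v w _ uv vw _ [e1 e10 H1] [e2 e20 H2]|u v m cu /andP[um mv] vd nr].
  exists (Num.min e1 e2); first by rewrite lt_min e10.
  move=> a b ab; rewrite !le_min => /andP[a1 a2] /andP[b1 b2].
  by rewrite (boundary_index_vert _ _ _ _ uv vw) H1// H2// addr0.
have near_itv a b e s : `|a - s0| <= e -> `|b - s0| <= e -> a <= s <= b -> `|s - s0| <= e.
  by rewrite !ler_norml; lra.
(* [[y, z]] is one half of the cell, and [x] is its end shared with the cell, the only point where
   roots may lie. *)
have half x y z : c <= x <= d -> x = y \/ x = z -> y < z -> u <= y -> z <= v ->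
    (forall r, y <= r <= z -> r = x \/ u < r < v) ->
    exists2 e, 0 < e & forall a b, a < b -> `|a - s0| <= e -> `|b - s0| <= e ->
    boundary_index U V a b y z = 0.
  move=> xcd xyz yz uy zv rx.
  have key G : G.[s0%:P] \in [:: U.[s0%:P]; V.[s0%:P]] -> G.[s0%:P].[x] != 0 ->
      exists2 e, 0 < e & forall s t, `|s - s0| <= e -> y <= t <= z -> G.[s%:P].[t] != 0.
    move=> Gin Gx; apply: noroot_near => // t tyz.
    have [->//|tuv] := rx t tyz; have [G0|nG] := nr _ Gin; last exact: nG.
    by move: Gx; rewrite G0 horner0 eqxx.
  have [Vx|Vx] := eqVneq V.[s0%:P].[x] 0.
    have [|e e0 H] := key U _ (co x xcd Vx); first by rewrite mem_head.
    exists e => // a b ab ha hb; apply: boundary_index_noroot => //; right=> s t sab.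
    by apply: H; apply: near_itv sab.
  have [|e e0 H] := key V _ Vx; first by rewrite !inE eqxx orbT.
  exists e => // a b ab ha hb; apply: boundary_index_noroot => //; left=> s t sab.
  by apply: H; apply: near_itv sab.
have uv := lt_trans um mv.
have [||||||e1 e10 H1] := half u u m; rewrite ?lexx ?(ltW mv)//.
- by rewrite cu (le_trans (ltW uv)).
- by left.
- move=> r /andP[]; rewrite le_eqVlt => /predU1P[->|ur rm]; [by left|right].
  by rewrite ur (le_lt_trans rm).
have [||||||e2 e20 H2] := half v m v; rewrite ?lexx ?(ltW um)//.
- by rewrite vd (le_trans cu (ltW uv)).
- by right.
- move=> r /andP[mr]; rewrite le_eqVlt => /predU1P[->|rv]; [by left|right].
  by rewrite rv (lt_le_trans um).
exists (Num.min e1 e2); first by rewrite lt_min e10.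
move=> a b ab; rewrite !le_min => /andP[a1 a2] /andP[b1 b2].
by rewrite (boundary_index_vert _ _ _ _ um mv) H1// H2// addr0.
Qed.

End Rectangles.

(** * Rectangles of any width: Sturm's algorithm with a parameter *)

Section RectangleVanishing.
Variable R : realFieldType.
Hypothesis rcR : real_closed R.
Implicit Types (a b c d s t x : R) (p g : {poly R}) (A B U V W : {poly {poly R}}).

Local Notation sg x := ((sgz x)%:~R : rat).

(** Evaluates the inner variable, the parameter, and keeps the outer one, in which the divisions are
    carried out. Hence the swaps when it meets [boundary_index]. *)
Definition spec s A : {poly R} := map_poly (horner_eval s) A.

Lemma horner_spec s A t : (spec s A).[t] = A.[t%:P].[s].
Proof.
by rewrite /spec -[X in _.[X]](hornerC t s) -/(horner_eval s t%:P) horner_map.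
Qed.

Lemma spec_swapXY s U : spec s (swapXY U) = U.[s%:P].
Proof. by rewrite /spec -horner_swapXY swapXYK. Qed.

Lemma sgz_same_side p s s' : s <= s' -> (p = 0 \/ forall x, s <= x <= s' -> p.[x] != 0) ->
  sgz p.[s] = sgz p.[s'].
Proof.
move=> ss' [->|nr]; first by rewrite !horner0.
move: ss'; rewrite le_eqVlt => /predU1P[->//|ss'].
have ns : p.[s] != 0 by rewrite nr// lexx ltW.
have ns' : p.[s'] != 0 by rewrite nr// lexx ltW.
have [/(rcR ss')[x /andP[sx xs'] px]|] := ltP (p.[s] * p.[s']) 0.
  by have := nr x; rewrite px eqxx !ltW// => /(_ isT).
rewrite -[0 <= _]sgz_ge0 sgzM; move: ns ns'.
by case: sgzP => //; case: sgzP.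
Qed.

(* Sturm's algorithm with parameter s: away from the roots of finitely many
   leading coefficients the pseudo-remainder sequence specializes, so the index
   is given by signs at the endpoints. *)
Lemma idx_spec_locally_constant c d A B : c < d ->
  exists2 D : {poly R}, D != 0 & forall s s', s <= s' ->
    (forall x, s <= x <= s' -> D.[x] != 0) ->
    coprime_on c d (spec s A) (spec s B) -> coprime_on c d (spec s' A) (spec s' B) ->
    idx c d (spec s A) (spec s B) = idx c d (spec s' A) (spec s' B).
Proof.
move=> cd; move: (leqnn (size A)); move: {2}(size A) => n.
elim: n A B => [|n IH] A B.
  rewrite size_poly_leq0 => /eqP->; exists 1; first exact: oner_neq0.
  by move=> s s' _ _ _ _; rewrite /idx /spec !rmorph0 !ratfun0l !Ind0.
move=> sA; have [->|A0] := eqVneq A 0.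
  exists 1; first exact: oner_neq0.
  by move=> s s' _ _ _ _; rewrite /idx /spec !rmorph0 !ratfun0l !Ind0.
(* Pseudo-division multiplies [B] by [e]; a second factor [e] makes the multiplier a square, which
   is positive wherever [e] does not vanish, so signs survive specialization. *)
pose e := lead_coef A ^+ Pdiv.IdomainDefs.scalp B A.
pose W : {poly {poly R}} := - (e *: Pdiv.IdomainDefs.modp B A).
have WE : (e * e) *: B = (e *: Pdiv.IdomainDefs.divp B A) * A - W.
  by rewrite /W opprK -scalerAl -scalerDr -Pdiv.Idomain.divp_eq scalerA.
have sW : (size W <= n)%N.
  rewrite size_polyN -ltnS (leq_trans _ sA)//.
  by rewrite (leq_ltn_trans (size_scale_leq _ _))// Pdiv.Idomain.ltn_modp.
have [D D0 HD] := IH W A sW.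
pose nz p : {poly R} := if p == 0 then 1 else p.
have nz0 p : nz p != 0 by rewrite /nz; case: ifPn => // _; exact: oner_neq0.
have e0 : e != 0 by rewrite expf_neq0// lead_coef_eq0.
clearbody W; move: e WE e0 => e WE e0.
(* The exceptional parameters are those of the recursive call, the roots of [e], and those where the
   endpoint signs of the reciprocity formula may change. *)
exists (D * e * nz (A * B).[d%:P] * nz (A * B).[c%:P]).
  by rewrite !mulf_neq0.
move=> s s' ss' nr co co'.
have nrE x : s <= x <= s' -> [/\ D.[x] != 0, e.[x] != 0, (nz (A * B).[d%:P]).[x] != 0 &
    (nz (A * B).[c%:P]).[x] != 0].
  by move=> /nr; rewrite !hornerM !mulf_eq0 !negb_or -!andbA => /and4P[].
have sgn t : (forall x, s <= x <= s' -> (nz (A * B).[t%:P]).[x] != 0) ->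
    sg ((spec s A).[t] * (spec s B).[t]) = sg ((spec s' A).[t] * (spec s' B).[t]).
  move=> nrt; have := @sgz_same_side (A * B).[t%:P] s s' ss'.
  rewrite !hornerM !horner_spec => -> //.
  have [AB0|AB0] := eqVneq (A * B).[t%:P] 0.
    by left; rewrite -hornerM.
  by right=> x /nrt; rewrite /nz (negPf AB0) hornerM.
have step x : s <= x <= s' -> coprime_on c d (spec x A) (spec x B) ->
    idx c d (spec x B) (spec x A) = - idx c d (spec x W) (spec x A) /\
    coprime_on c d (spec x W) (spec x A).
  move=> /nrE[_ ex _ _] cx.
  have key t : c <= t <= d -> (spec x A).[t] = 0 -> (spec x B).[t] != 0 /\
      sgz (spec x B).[t] = - sgz (spec x W).[t].
    move=> tcd At; have Bt := coprime_onC cx tcd At; split=> //.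
    have /(congr1 (fun p : {poly {poly R}} => (spec x p).[t])) := WE.
    rewrite !horner_spec in At Bt *.
    rewrite !hornerE /= At mulr0 sub0r => /(congr1 (@sgz R)).
    have e20 : 0 < e.[x] * e.[x] by rewrite lt_def mulf_neq0// -expr2 sqr_ge0.
    rewrite sgzN => <-.
    by rewrite (sgzM (e.[x] * e.[x])) (gtr0_sgz e20) mul1r.
  split; first exact: (idx_congr rcR cd).
  move=> t tcd /(key t tcd)[Bt e2]; apply: contraNneq Bt => Wt.
  by rewrite -sgz_eq0 e2 Wt sgz0 oppr0.
have sss : s <= s <= s' by rewrite lexx.
have sss' : s <= s' <= s' by rewrite lexx andbT.
have [e1 cW1] := step s sss co; have [e2 cW2] := step s' sss' co'.
have r1 := idx_reciprocity rcR cd co; have r2 := idx_reciprocity rcR cd co'.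
have eD := HD s s' ss' (fun x h => let: And4 h1 _ _ _ := nrE x h in h1) cW1 cW2.
have h1 := sgn c (fun x h => let: And4 _ _ _ h1 := nrE x h in h1).
have h2 := sgn d (fun x h => let: And4 _ _ h1 _ := nrE x h in h1).
lra.
Qed.

(** Thin strips at both ends of a cell have index 0. In between, the index along [s = const] does
    not change and the two horizontal sides meet no zero of [V], or [V] vanishes identically along
    them. *)
Lemma boundary_index0 U V a b c d : a < b -> c < d ->
  (forall s t, a <= s <= b -> c <= t <= d ->
     V.[s%:P].[t] = 0 -> U.[s%:P].[t] != 0) ->
  boundary_index U V a b c d = 0.
Proof.
move=> ab cd co; have [D D0 HD] := idx_spec_locally_constant (swapXY U) (swapXY V) cd.
pattern a, b.
apply: (split_ind_in (ps := [:: D; (swapXY V).[d%:P]; (swapXY V).[c%:P]]) ab) =>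
    [u v w au uv vw wb e1 e2|u v m au /andP[um mv] vb nr].
  by rewrite (boundary_index_horiz _ _ _ _ uv vw) e1 e2 addr0.
have uv := lt_trans um mv.
have uab : a <= u <= b by rewrite au (le_trans (ltW uv)).
have vab : a <= v <= b by rewrite vb (le_trans au (ltW uv)).
have [e1 e10 H1] := boundary_index_near rcR cd (fun t => co u t uab).
have [e2 e20 H2] := boundary_index_near rcR cd (fun t => co v t vab).
(* The midpoints keep [u'] left and [v'] right of [m], so the middle rectangle lies inside the cell,
   away from the exceptional parameters. *)
pose u' := Num.min (u + e1) ((u + m) / 2); pose v' := Num.max (v - e2) ((m + v) / 2).
have [um1 um2] := (midf_lt um).
have uu' : u < u' by rewrite lt_min ltrDl e10 midf_lt.
have u'm : u' < m by rewrite gt_min midf_lt// orbT.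
have mv' : m < v' by rewrite lt_max midf_lt// orbT.
have v'v : v' < v by rewrite gt_max ltrBlDr ltrDl e20 midf_lt.
have u'v' := lt_trans u'm mv'.
have nr' p : p \in [:: D; (swapXY V).[d%:P]; (swapXY V).[c%:P]] ->
    p = 0 \/ forall x, u' <= x <= v' -> p.[x] != 0.
  move=> /nr[|nrp]; [by left|right=> x /andP[ux xv]].
  by apply: nrp; rewrite (lt_le_trans uu') ?(le_lt_trans xv).
rewrite (boundary_index_horiz _ _ _ _ uu' (lt_trans u'v' v'v)).
rewrite (boundary_index_horiz _ _ _ _ u'v' v'v).
rewrite (H1 u u') ?subrr ?normr0 ?(ltW e10)//; last first.
  by rewrite ger0_norm ?subr_ge0 ?(ltW uu')// lerBlDl ge_min lexx.
rewrite (H2 v' v) ?subrr ?normr0 ?(ltW e20)//; last first.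
  by rewrite ler0_norm ?subr_le0 ?(ltW v'v)// opprB lerBlDl -lerBlDr le_max lexx.
have horiz t : (swapXY V).[t%:P] \in [:: D; (swapXY V).[d%:P]; (swapXY V).[c%:P]] ->
    idx u' v' (swapXY U).[t%:P] (swapXY V).[t%:P] = 0.
  move=> /nr'[->|nrt]; first by rewrite /idx ratfun0r Ind0.
  exact: (idx_noroot rcR).
rewrite /boundary_index !horiz ?inE ?eqxx ?orbT// subrr subr0 addr0 add0r.
have u'ab : a <= u' <= b.
  by rewrite (le_trans au (ltW uu')) (le_trans (ltW u'v') (le_trans (ltW v'v) vb)).
have v'ab : a <= v' <= b.
  by rewrite (le_trans au (ltW (lt_trans uu' u'v'))) (le_trans (ltW v'v) vb).
rewrite -!spec_swapXY (HD u' v' (ltW u'v')) ?subrr//.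
- have [D0'|//] := nr' D (mem_head _ _); by rewrite D0' eqxx in D0.
- by move=> t tcd; rewrite !spec_swapXY; exact: co.
- by move=> t tcd; rewrite !spec_swapXY; exact: co.
Qed.

End RectangleVanishing.

(** * Half planes and lifts of directions *)

Section Tilings.
Variables (R : realFieldType) (X : Type) (x0 : X).
Implicit Types (a b c : R) (Cell : R -> R -> X -> Prop).

Definition tiled Cell a b := exists n (r : nat -> R) (c : nat -> X),
  [/\ r 0%N = a, r n = b & forall k, (k < n)%N -> r k < r k.+1 /\ Cell (r k) (r k.+1) (c k)].

Lemma tiled_refl Cell a : tiled Cell a a.
Proof. by exists 0%N, (fun=> a), (fun=> x0). Qed.

Lemma tiled_one Cell a b x : a < b -> Cell a b x -> tiled Cell a b.
Proof.
by move=> ab Cab; exists 1%N, (fun k => if k is 0 then a else b), (fun=> x); split=> // -[].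
Qed.

Lemma tiled_cat Cell a b c : tiled Cell a b -> tiled Cell b c -> tiled Cell a c.
Proof.
move=> [n [r [f [r0 rn rP]]]] [m [s [g [s0 sm sP]]]].
exists (n + m)%N, (fun k => if (k < n)%N then r k else s (k - n)%N),
  (fun k => if (k < n)%N then f k else g (k - n)%N); split.
- by case: n r0 rn {rP} => [<- ->|]//; rewrite subnn.
- by rewrite -ltn_subRL subnn ltn0 addKn.
move=> k knm; have [kn|nk] := ltnP k n.
  have [kn'|] := ltnP k.+1 n; first exact: rP.
  rewrite leq_eqVlt ltnNge kn orbF => /eqP nE; have := rP k kn.
  by rewrite -nE rn nE subnn s0.
have -> : (k.+1 < n)%N = false by apply/negbTE; rewrite -leqNgt leqW.
by rewrite subSn//; apply: sP; rewrite ltn_subLR.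
Qed.

End Tilings.

(** * Half planes centred at quarter turns, and the index of a path inside one of them *)

Section Sectors.
Variable R : realFieldType.
Implicit Types (a b x : R) (P Q : {poly R[i]}) (z : R[i]) (k l : int).

Local Notation sg x := ((sgz x)%:~R : rat).

(* The cosine of k quarter turns. *)
Definition qcos k : R := match (k %% 4)%Z with Posz 0 => 1 | Posz 2 => -1 | _ => 0 end.

(* Re (z * conj ('i ^ k)): positive on the open half plane centred at 'i ^ k. *)
Definition halfplane k z : R := complex.Re z * qcos k + complex.Im z * qcos (k - 1).

Lemma modz4 k : [\/ (k %% 4)%Z = 0, (k %% 4)%Z = 1, (k %% 4)%Z = 2 | (k %% 4)%Z = 3].
Proof.
have : (0 <= k %% 4 < 4)%Z by rewrite modz_ge0// ltz_mod.
case: (k %% 4)%Z => // -[|[|[|[|j]]]] // _; by [constructor 1|constructor 2|constructor 3|constructor 4].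
Qed.

Lemma qcos_mod k l : (k = l %[mod 4])%Z -> qcos k = qcos l.
Proof. by rewrite /qcos => ->. Qed.

Lemma qcos_cases k :
  [\/ [/\ qcos k = 1, qcos (k - 1) = 0 & qcos (k + 1) = 0],
      [/\ qcos k = 0, qcos (k - 1) = 1 & qcos (k + 1) = -1],
      [/\ qcos k = -1, qcos (k - 1) = 0 & qcos (k + 1) = 0] |
      [/\ qcos k = 0, qcos (k - 1) = -1 & qcos (k + 1) = 1]].
Proof.
rewrite /qcos -(modzDml k (-1)) -(modzDml k 1).
case: (modz4 k) => ->; by [constructor 1|constructor 2|constructor 3|constructor 4].
Qed.

Lemma qcosD2 k : qcos (k + 2) = - qcos k.
Proof.
rewrite /qcos -(modzDml k 2).
by case: (modz4 k) => ->; rewrite /= ?oppr0 ?opprK.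
Qed.

Lemma halfplane_mod k l z : (k = l %[mod 4])%Z -> halfplane k z = halfplane l z.
Proof.
move=> kl; rewrite /halfplane (qcos_mod kl); congr (_ + _ * _); apply: qcos_mod.
by rewrite -modzDml kl modzDml.
Qed.

Lemma halfplaneD2 k z : halfplane (k + 2) z = - halfplane k z.
Proof.
rewrite /halfplane qcosD2 addrAC qcosD2; ring.
Qed.

(* The argument of z in quarter turns, on the branch fixed by the half plane k,
   each open half plane of im != 0 being collapsed to its (odd) middle direction. *)
Definition theta k z : rat :=
  k%:~R + (if qcos k == 0 then 0 else sg (complex.Re z * complex.Im z)).

Lemma thetaD4 k l z : theta (k + l * 4) z = theta k z + 4 * l%:~R.
Proof.
rewrite /theta (@qcos_mod (k + l * 4) k) ?modzMDr//; first by rewrite intrD intrM; ring.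
by rewrite addrC modzMDl.
Qed.

(** Two adjacent half planes meet in an open quadrant. One of the two branches is constant, and on
    that quadrant the sign of re times im moves the even branch by one step to the odd value. *)
Lemma theta_adjacent k l z : 0 < halfplane k z -> 0 < halfplane l z ->
  `|k - l| <= 1 -> theta k z = theta l z.
Proof.
wlog kl : k l / k <= l => [W hk hl d|].
  by have [/W->|/ltW/W->] := leP k l; rewrite // distrC.
move=> hk hl d; have [->//|lE] : k = l \/ l = k + 1 by lia.
move: hk hl; rewrite /theta lE /halfplane addrK sgzM intrM.
have [[-> -> ->]|[-> -> ->]|[-> -> ->]|[-> -> ->]] := qcos_cases k;
  rewrite ?mulr0 ?mulr1 ?mulrN1 ?addr0 ?add0r ?eqxx ?oner_eq0 ?oppr_eq0 ?oner_eq0 => h1 h2.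
- by rewrite (gtr0_sgz h1) (gtr0_sgz h2) intrD; ring.
- by rewrite oppr_gt0 in h2; rewrite (gtr0_sgz h1) (ltr0_sgz h2) intrD; ring.
- rewrite oppr_gt0 in h1; rewrite oppr_gt0 in h2.
  by rewrite (ltr0_sgz h1) (ltr0_sgz h2) intrD; ring.
- by rewrite oppr_gt0 in h1; rewrite (ltr0_sgz h1) (gtr0_sgz h2) intrD; ring.
Qed.

Hypothesis rcR : real_closed R.

(** For odd [k] the imaginary part has no zero and both sides are 0; for even [k] the real part has
    none and reciprocity gives the difference of signs. *)
Lemma cindex_cell_sector a b P k : a < b ->
  (forall x, a <= x <= b -> 0 < halfplane k P.[x%:C]) ->
  2 * cindex_cell a b P = theta k P.[b%:C] - theta k P.[a%:C].
Proof.
move=> ab hP; rewrite /theta /cindex_cell !horner_reim /=.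
have nz (g : {poly R}) (h : forall x, a <= x <= b -> 0 < g.[x] \/ 0 < - g.[x]) :
    forall x, a <= x <= b -> g.[x] != 0.
  by move=> x /h []; [move/gt_eqF->|rewrite oppr_gt0 => /lt_eqF->].
have hP' x : a <= x <= b -> 0 < (poly_re P).[x] * qcos k + (poly_im P).[x] * qcos (k - 1).
  by move=> /hP; rewrite horner_reim.
move: hP'; have [[-> -> _]|[-> -> _]|[-> -> _]|[-> -> _]] := qcos_cases k => {}hP;
  rewrite ?eqxx ?oner_eq0 ?oppr_eq0 ?oner_eq0.
- rewrite (idx_num_noroot rcR _ ab); first by ring.
  by apply: nz => x /hP; rewrite mulr1 mulr0 addr0; left.
- rewrite (idx_noroot rcR _ ab); first by ring.
  by apply: nz => x /hP; rewrite mulr1 mulr0 add0r; left.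
- rewrite (idx_num_noroot rcR _ ab); first by ring.
  by apply: nz => x /hP; rewrite mulrN1 mulr0 addr0; right.
- rewrite (idx_noroot rcR _ ab); first by ring.
  by apply: nz => x /hP; rewrite mulrN1 mulr0 add0r; right.
Qed.

(** On each half of a cell without inner roots, re or im is nonzero at the outer end, hence
    throughout the half, and its sign selects a half plane. *)
Lemma halfplane_cover a b P : a < b ->
  (forall x, a <= x <= b -> P.[x%:C] != 0) ->
  tiled (fun u v k => forall x, u <= x <= v -> 0 < halfplane k P.[x%:C]) a b.
Proof.
move=> ab nP; pattern a, b.
apply: (split_ind_in (ps := [:: poly_re P; poly_im P]) ab) => [u v w _ _ _ _|u v m au /andP[um mv] vb nr].
  exact: tiled_cat.
have uv := lt_trans um mv.
have cell (y z : R) : y < z -> (forall x, y <= x <= z -> (poly_re P).[x] != 0) \/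
    (forall x, y <= x <= z -> (poly_im P).[x] != 0) ->
    tiled (fun u v k => forall x, u <= x <= v -> 0 < halfplane k P.[x%:C]) y z.
  move=> yz nz.
  have cst (g : {poly R}) : (forall x, y <= x <= z -> g.[x] != 0) ->
      (forall x, y <= x <= z -> 0 < g.[x]) \/ (forall x, y <= x <= z -> 0 < - g.[x]).
    move=> ng; have S x : y <= x <= z -> sgz g.[x] = sgz g.[y].
      move=> /andP[yx xz]; apply/esym; apply: (sgz_same_side rcR yx).
      by right=> t /andP[yt tx]; rewrite ng// yt (le_trans tx).
    have [g0|g0|g0] := ltgtP g.[y] 0.
    - by right=> x /S e; rewrite oppr_gt0 -sgz_lt0 e sgz_lt0.
    - by left=> x /S e; rewrite -sgz_gt0 e sgz_gt0.
    - by have := ng y; rewrite g0 eqxx lexx ltW// => /(_ isT).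
  case: nz => /cst [] h.
  - apply: (tiled_one (x := 0)) => // x /h; by rewrite horner_reim /halfplane /qcos /= mulr0 mulr1 addr0.
  - apply: (tiled_one (x := 2)) => // x /h; by rewrite horner_reim /halfplane /qcos /= mulr0 mulrN1 addr0.
  - apply: (tiled_one (x := 1)) => // x /h; by rewrite horner_reim /halfplane /qcos /= mulr0 mulr1 add0r.
  - apply: (tiled_one (x := 3)) => // x /h; by rewrite horner_reim /halfplane /qcos /= mulr0 mulrN1 add0r.
have half (y y1 y2 : R) : u <= y1 -> y2 <= v -> y1 < y2 -> a <= y <= b ->
    (forall x, y1 <= x <= y2 -> x = y \/ u < x < v) ->
    tiled (fun u v k => forall x, u <= x <= v -> 0 < halfplane k P.[x%:C]) y1 y2.
  move=> uy1 y2v y12 yab hy; apply: cell => //.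
  have nrg g : g \in [:: poly_re P; poly_im P] -> g.[y] != 0 ->
      forall x, y1 <= x <= y2 -> g.[x] != 0.
    move=> gin gy x /hy[->//|xuv]; have [g0|] := nr g gin; last exact.
    by rewrite g0 horner0 eqxx in gy.
  have := nP y yab; rewrite horner_reim eq_complex /= negb_and => /orP[] gy.
    by left; apply: nrg => //; rewrite mem_head.
  by right; apply: nrg => //; rewrite !inE eqxx orbT.
apply: (tiled_cat (b := m)).
  apply: (half u) => //; rewrite ?(ltW mv)// ?au ?(le_trans (ltW uv))//.
  move=> x /andP[]; rewrite le_eqVlt => /predU1P[->|ux xm]; [by left|right].
  by rewrite ux (le_lt_trans xm).
apply: (half v) => //; rewrite ?(ltW um)// ?vb ?andbT ?(le_trans au (ltW uv))//.
move=> x /andP[mx]; rewrite le_eqVlt => /predU1P[->|xv]; [by left|right].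
by rewrite xv (lt_le_trans um).
Qed.

End Sectors.

(** * Integer lifts of the direction of a loop, and integrality of the index *)

Section LoopSectors.
Variable R : realFieldType.
Implicit Types (a b x : R) (g : itv01 R -> R[i]).

(* Extension by 0 outside [0, 1]. *)
Definition ext g x : R[i] := oapp g 0 (insub x).

Lemma extE g (y : itv01 R) : ext g (val y) = g y.
Proof. by rewrite /ext valK. Qed.

Lemma ext_presents g n t (P : nat -> {poly R[i]}) k x :
  presents g n t P -> (k < n)%N -> t k <= x <= t k.+1 -> ext g x = (P k).[x%:C].
Proof.
move=> [tS gP] kn xk; have x01 := presents_sub01 tS kn xk.
by rewrite -(gP k kn (mk01 x01) xk) -extE.
Qed.

Lemma presents_ext g n t (P : nat -> {poly R[i]}) : subdivision n t ->
  (forall k, (k < n)%N -> forall x, t k <= x <= t k.+1 -> ext g x = (P k).[x%:C]) ->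
  presents g n t P.
Proof. by move=> tS H; split=> // k kn x xk; rewrite -extE; apply: H. Qed.

Lemma direction_lift n (d : nat -> int) (z : nat -> R[i]) :
  (forall i, (i < n)%N -> 0 < halfplane (d i) (z i) /\ 0 < halfplane (d i.+1) (z i)) ->
  exists k : nat -> int, (forall i, (i <= n)%N -> (k i = d i %[mod 4])%Z) /\
    (forall i, (i < n)%N -> `|k i.+1 - k i| <= 1).
Proof.
move=> H.
(* The next value is the representative of [d j.+1] modulo 4 between [k j - 1] and [k j + 2]. The
   value [k j + 2] is impossible because opposite half planes are disjoint, so steps are at most
   1. *)
pose k := fix k i := if i is j.+1 then k j + ((d j.+1 - k j + 1) %% 4)%Z - 1 else d 0%N.
have kS i : k i.+1 = k i + ((d i.+1 - k i + 1) %% 4)%Z - 1 by [].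
have kd i : (k i = d i %[mod 4])%Z.
  case: i => // i; rewrite kS -addrA addrC -addrA modzDml.
  by congr (_ %% _)%Z; ring.
exists k; split=> // i i_n; have [h1 h2] := H i i_n.
rewrite kS; have e0 : k i + ((d i.+1 - k i + 1) %% 4)%Z - 1 - k i = ((d i.+1 - k i + 1) %% 4)%Z - 1 by ring.
rewrite e0; case: (modz4 (d i.+1 - k i + 1)) => [->|->|->|e] //.
have : (d i.+1 = k i + 2 %[mod 4])%Z.
  have -> : d i.+1 = (d i.+1 - k i + 1) + (k i - 1) by ring.
  by rewrite -modzDml e; have -> : 3 + (k i - 1) = k i + 2 :> int by ring.
move=> /halfplane_mod e2; move: h2; rewrite e2 halfplaneD2 (halfplane_mod _ (kd i)).
by rewrite oppr_gt0 ltNge ltW.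
Qed.

Hypothesis rcR : real_closed R.

Lemma sector_lift (gamma : Omega R) : exists n t (P : nat -> {poly R[i]}) k K,
  [/\ presents gamma n t P,
    forall i, (i < n)%N -> forall x, t i <= x <= t i.+1 -> 0 < halfplane (k i) (P i).[x%:C],
    forall i, (i < n)%N -> `|k i.+1 - k i| <= 1 &
    k n = k 0%N + K * 4].
Proof.
have [n0 [t0' [P0 pP0]]] := loop_piecewise gamma; have [tS _] := pP0.
have [h0 h1 tlt] := tS.
pose Cell u v (c : {poly R[i]} * int) := forall x, u <= x <= v ->
  ext gamma x = c.1.[x%:C] /\ 0 < halfplane c.2 c.1.[x%:C].
have T j : (j <= n0)%N -> tiled Cell 0 (t0' j).
  elim: j => [|j IH] jn; first by rewrite h0; exact: (tiled_refl (0, 0)).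
  apply: tiled_cat (IH (ltnW jn)) _.
  have nz x : t0' j <= x <= t0' j.+1 -> (P0 j).[x%:C] != 0.
    move=> xj; rewrite -(ext_presents pP0 jn xj).
    by rewrite -[x]/(val (mk01 (presents_sub01 tS jn xj))) extE loop_neq0.
  have [m [r [c [r0 rm rP]]]] := halfplane_cover rcR (tlt j jn) nz.
  exists m, r, (fun i => (P0 j, c i)); split=> // i im.
  have [ri ci] := rP i im; split=> // x xi /=; split; last exact: ci.
  apply: (ext_presents pP0 jn).
  have mono p q : (p <= q <= m)%N -> r p <= r q.
    elim: q => [|q IHq] /andP[pq qm]; first by move: pq; rewrite leqn0 => /eqP->.
    move: pq; rewrite leq_eqVlt => /orP[/eqP->//|pq].
    apply: le_trans (IHq _) (ltW (rP q qm).1).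
    by rewrite -ltnS pq ltnW.
  move: xi => /andP[rx xr]; rewrite -r0 -rm.
  rewrite (le_trans (mono 0%N i _) rx) ?(ltnW im)//.
  by rewrite (le_trans xr (mono i.+1 m _))// im leqnn.
have := T n0 (leqnn _); rewrite h1 => -[n [t [c [r0 rn rP]]]].
have sS : subdivision n t by split=> // k kn; have [] := rP k kn.
(* The direction at index [n] is that of the first cell: the lift then compares the last cell with
   the first at the base point, and its total change is a multiple of 4. *)
pose P i := (c i).1; pose d i := if (i < n)%N then (c i).2 else (c 0%N).2.
have n_gt0 : (0 < n)%N.
  by case: n r0 rn {rP sS d} => // -> /esym/eqP; rewrite oner_eq0.
have pP : presents gamma n t P.
  by apply: presents_ext => // k kn x xk; have [_ H] := rP k kn; have [] := H x xk.
have hP i x : (i < n)%N -> t i <= x <= t i.+1 -> 0 < halfplane (c i).2 (ext gamma x).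
  by move=> i_n xi; have [_ H] := rP i i_n; have [->] := H x xi.
have e01 : ext gamma 0 = ext gamma 1.
  by rewrite -[0]/(val (t0 R)) -[1]/(val (t1 R)) !extE loop_closed.
have dP i : (i < n)%N -> 0 < halfplane (d i) (ext gamma (t i.+1)) /\
    0 < halfplane (d i.+1) (ext gamma (t i.+1)).
  move=> i_n; have ti : t i < t i.+1 by have [] := rP i i_n.
  split; first by rewrite /d i_n hP// lexx ltW.
  rewrite /d; case: ltnP => iSn.
    by apply: hP => //; rewrite lexx ltW//; have [] := rP _ iSn.
  have -> : i.+1 = n by apply/eqP; rewrite eqn_leq iSn i_n.
  have := hP 0%N (t 0%N) n_gt0; rewrite rn -e01 r0; apply.
  by rewrite lexx -{1}r0 ltW//; have [] := rP 0%N n_gt0.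
have [k [kd kk]] := direction_lift dP.
have dn : d n = d 0%N by rewrite /d ltnn n_gt0.
have /eqP : (k n = k 0%N %[mod 4])%Z by rewrite (kd n (leqnn n)) dn -(kd 0%N (leq0n n)).
rewrite eqz_mod_dvd.
move=> /dvdzP[K KE].
exists n, t, P, k, K; split=> //.
  move=> i i_n x xi; rewrite (halfplane_mod _ (kd i (ltnW i_n))) /d i_n.
  by rewrite -(ext_presents pP i_n xi); apply: hP.
by rewrite -KE addrC subrK.
Qed.

(** Twice the index of a cell is the change of [theta] on its branch, and adjacent branches agree at
    division points. The telescoping sum leaves the [4 * K] by which the branches at the base point
    differ. *)
Lemma half_cauchy_index_lift (gamma : Omega R) n t (P : nat -> {poly R[i]}) k K :
  presents gamma n t P ->
  (forall i, (i < n)%N -> forall x, t i <= x <= t i.+1 -> 0 < halfplane (k i) (P i).[x%:C]) ->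
  (forall i, (i < n)%N -> `|k i.+1 - k i| <= 1) ->
  k n = k 0%N + K * 4 -> half_cauchy_index n t P = K%:~R.
Proof.
move=> pP hP kk kn; have [tS _] := pP; have [h0 h1 tlt] := tS.
pose z i := ext gamma (t i).
have e01 : z 0%N = z n.
  by rewrite /z h0 h1 -[0]/(val (t0 R)) -[1]/(val (t1 R)) !extE loop_closed.
have n_gt0 : (0 < n)%N.
  by rewrite lt0n; apply/eqP => n0; move: h1; rewrite n0 h0 => /esym/eqP; rewrite oner_eq0.
have lo i : (i < n)%N -> t i <= t i <= t i.+1 by move=> i_n; rewrite lexx ltW// tlt.
have hi i : (i < n)%N -> t i <= t i.+1 <= t i.+1 by move=> i_n; rewrite lexx ltW// tlt.
have hz i : (i < n)%N -> 0 < halfplane (k i) (z i) /\ 0 < halfplane (k i) (z i.+1).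
  by move=> i_n; rewrite /z !(ext_presents pP i_n) ?lo ?hi//; split; apply: hP; rewrite // ?lo ?hi.
have step i : (i < n)%N ->
    2 * cindex_cell (t i) (t i.+1) (P i) = theta (k i.+1) (z i.+1) - theta (k i) (z i).
  move=> i_n; rewrite (cindex_cell_sector rcR (tlt i i_n) (hP i i_n)).
  rewrite -!(ext_presents pP i_n) ?lo ?hi// -/(z i) -/(z i.+1).
  congr (_ - _); apply: theta_adjacent; last by rewrite distrC kk.
    by have [] := hz i i_n.
  have [iSn|] := ltnP i.+1 n; first by have [] := hz _ iSn.
  rewrite leq_eqVlt ltnNge i_n orbF => /eqP nE.
  rewrite -nE -e01 kn (halfplane_mod (l := k 0%N)) ?modzMDr//; first by have [] := hz _ n_gt0.
  by rewrite addrC modzMDl.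
apply: (@mulfI _ 4) => //; rewrite half_cauchy_indexE.
have -> : 4 * (2^-1 * \sum_(i < n) cindex_cell (t i) (t i.+1) (P i)) =
    \sum_(i < n) 2 * cindex_cell (t i) (t i.+1) (P i).
  by rewrite mulrA -mulr_sumr; congr (_ * _).
rewrite (eq_bigr (fun i : 'I_n => theta (k i.+1) (z i.+1) - theta (k i) (z i))); last first.
  by move=> i _; rewrite step.
rewrite -(big_mkord xpredT (fun i => theta (k i.+1) (z i.+1) - theta (k i) (z i))).
rewrite (telescope_sumr (fun i => theta (k i) (z i)))//.
by rewrite -e01 kn thetaD4; ring.
Qed.

Lemma half_cauchy_index_int (gamma : Omega R) :
  exists K : int, forall n t (P : nat -> {poly R[i]}), presents gamma n t P ->
    half_cauchy_index n t P = K%:~R.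
Proof.
have [n [t [P [k [K [pP hP kk kn]]]]]] := sector_lift gamma.
exists K => n' t' P' pP'; rewrite (half_cauchy_index_uniq pP' pP).
exact: half_cauchy_index_lift pP hP kk kn.
Qed.

End LoopSectors.

(** * Real and imaginary parts of polynomials *)

Section ComplexPolynomials.
Variable R : realFieldType.
Implicit Types (a b x : R) (P Q : {poly R[i]}) (p q A B : {poly R}) (z u v : R[i]).

Lemma Re_add u v : complex.Re (u + v) = complex.Re u + complex.Re v.
Proof. by case: u; case: v. Qed.
Lemma Im_add u v : complex.Im (u + v) = complex.Im u + complex.Im v.
Proof. by case: u; case: v. Qed.

Lemma poly_reD P Q : poly_re (P + Q) = poly_re P + poly_re Q.
Proof. by apply/polyP => i; rewrite coefD !coef_poly_re coefD Re_add. Qed.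
Lemma poly_imD P Q : poly_im (P + Q) = poly_im P + poly_im Q.
Proof. by apply/polyP => i; rewrite coefD !coef_poly_im coefD Im_add. Qed.

Definition complex_poly A B : {poly R[i]} :=
  map_poly (real_complex R) A + (0 +i* 1 : R[i])%:P * map_poly (real_complex R) B.

Lemma poly_re_complex A B : poly_re (complex_poly A B) = A.
Proof.
apply/polyP => i; rewrite coef_poly_re coefD coefCM !coef_map.
by rewrite /= mul0r mul1r subr0 addr0.
Qed.

Lemma poly_im_complex A B : poly_im (complex_poly A B) = B.
Proof.
apply/polyP => i; rewrite coef_poly_im coefD coefCM !coef_map.
by rewrite /= mul0r mul1r !add0r.
Qed.

Lemma poly_mulE P Q : P * Q =
  complex_poly (poly_re P * poly_re Q - poly_im P * poly_im Q)
               (poly_re P * poly_im Q + poly_re Q * poly_im P).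
Proof.
rewrite {1}[P]poly_reimE {1}[Q]poly_reimE /complex_poly !rmorphB !rmorphD !rmorphM /=.
set i := _%:P; have -> : i = (0 +i* 1 : R[i])%:P by [].
have i2 : (0 +i* 1 : R[i])%:P * (0 +i* 1 : R[i])%:P = -1.
  rewrite -polyCM -polyCN; congr (_%:P).
  by apply/eqP; rewrite eq_complex /= !(mul0r, mulr0, mul1r, sub0r, addr0, oppr0) !eqxx.
move: (0 +i* 1)%:P i2 => j j2.
set a := map_poly _ _; set b := map_poly _ _; set c := map_poly _ _; set d := map_poly _ _.
transitivity (a * c + (j * j) * (b * d) + j * (a * d + c * b)); first by ring.
by rewrite j2; ring.
Qed.

Lemma poly_reM P Q : poly_re (P * Q) = poly_re P * poly_re Q - poly_im P * poly_im Q.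
Proof. by rewrite poly_mulE poly_re_complex. Qed.

Lemma poly_imM P Q : poly_im (P * Q) = poly_re P * poly_im Q + poly_re Q * poly_im P.
Proof. by rewrite poly_mulE poly_im_complex. Qed.

Lemma poly_reC z : poly_re z%:P = (complex.Re z)%:P.
Proof. by apply/polyP => i; rewrite coef_poly_re !coefC; case: eqP. Qed.
Lemma poly_imC z : poly_im z%:P = (complex.Im z)%:P.
Proof. by apply/polyP => i; rewrite coef_poly_im !coefC; case: eqP. Qed.
Lemma poly_reX : poly_re ('X : {poly R[i]}) = 'X.
Proof. by apply/polyP => i; rewrite coef_poly_re !coefX; case: eqP. Qed.
Lemma poly_imX : poly_im ('X : {poly R[i]}) = 0.
Proof. by apply/polyP => i; rewrite coef_poly_im !coefX coef0; case: eqP. Qed.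

Definition poly_reimW := (poly_reD, poly_imD, poly_reM, poly_imM, poly_reC, poly_imC, poly_reX, poly_imX).

Lemma eq_rpoly_itv a b p q : a < b -> (forall x, a <= x <= b -> p.[x] = q.[x]) -> p = q.
Proof.
move=> ab pq; rewrite -(poly_re_complex p 0) -(poly_re_complex q 0).
congr poly_re; apply: (eq_poly_itv ab) => x /pq e.
by rewrite /complex_poly rmorph0 mulr0 !addr0 !horner_map /= e.
Qed.

Definition poly2_re (F : {poly {poly R[i]}}) : {poly {poly R}} := map_poly (@poly_re R) F.
Definition poly2_im (F : {poly {poly R[i]}}) : {poly {poly R}} := map_poly (@poly_im R) F.

Lemma poly2_re_horner F x : (poly2_re F).[x%:P] = poly_re F.[x%:C%:P].
Proof.
rewrite (@horner_coef_wide _ (size F)) ?size_poly// horner_coef.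
rewrite (big_morph (@poly_re R) poly_reD (map_poly0 _)); apply: eq_bigr => i _.
rewrite coef_map_id0 ?[poly_re 0]map_poly0// -!polyC_exp -rmorphXn /=.
by rewrite !poly_reM !poly_reC !poly_imC /= polyC0 mulr0 subr0.
Qed.

Lemma poly2_im_horner F x : (poly2_im F).[x%:P] = poly_im F.[x%:C%:P].
Proof.
rewrite (@horner_coef_wide _ (size F)) ?size_poly// horner_coef.
rewrite (big_morph (@poly_im R) poly_imD (map_poly0 _)); apply: eq_bigr => i _.
rewrite coef_map_id0 ?[poly_im 0]map_poly0// -!polyC_exp -rmorphXn /=.
by rewrite !poly_imM !poly_imC !poly_reC /= polyC0 mulr0 add0r mulrC.
Qed.

End ComplexPolynomials.

(** * The winding number over a real closed field *)

Section Presenting.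
Variable R : realFieldType.
Implicit Types (a b x s t : R) (g h : itv01 R -> R[i]).

Lemma presentsM g h n (t : nat -> R) (P Q : nat -> {poly R[i]}) : presents g n t P ->
  presents h n t Q -> presents (fun x : itv01 R => g x * h x) n t (fun k => P k * Q k).
Proof.
by move=> [tS gP] [_ hQ]; split=> // k kn x xk; rewrite hornerM -gP// -hQ.
Qed.

Definition linear_poly (u v : R[i]) : {poly R[i]} := u%:P + v%:P * 'X.

Definition rect_poly (x0 x1 y0 y1 : R) (k : nat) : {poly R[i]} :=
  match k with
  | 0 => linear_poly (x0 +i* y0) (4 * (x1 - x0) +i* 0)
  | 1 => linear_poly (x1 +i* (y0 - (y1 - y0))) (0 +i* (4 * (y1 - y0)))
  | 2 => linear_poly ((x1 - 2 * (x0 - x1)) +i* y1) (4 * (x0 - x1) +i* 0)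
  | _ => linear_poly (x0 +i* (y1 - 3 * (y0 - y1))) (0 +i* (4 * (y0 - y1)))
  end.

Lemma linear_poly_re u v x : (poly_re (linear_poly u v)).[x] = complex.Re u + complex.Re v * x.
Proof. by rewrite !poly_reimW /= mulr0 subr0 hornerD hornerM !hornerC hornerX. Qed.

Lemma linear_poly_im u v x : (poly_im (linear_poly u v)).[x] = complex.Im u + complex.Im v * x.
Proof. by rewrite !poly_reimW /= mulr0 add0r hornerD hornerM !hornerC hornerX mulrC. Qed.

Lemma rect_subdivision : subdivision 4 (fun k => k%:R / 4 : R).
Proof.
split; first by rewrite mul0r.
  by rewrite divff ?pnatr_eq0.
by move=> k _; rewrite ltr_pM2r ?invr_gt0// ltr_nat.
Qed.

Lemma rect_presents x0 x1 y0 y1 :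
  presents (rect_boundary x0 x1 y0 y1) 4 (fun k => k%:R / 4) (rect_poly x0 x1 y0 y1).
Proof.
split; first exact: rect_subdivision.
move=> k k4 y; rewrite horner_reim /rect_boundary; move: (val y) => x.
case: k k4 => [|[|[|[|//]]]] _ /andP[l r]; rewrite linear_poly_re linear_poly_im /=;
  move: l r; rewrite ?mul0r => l r.
- rewrite ifT//; apply/eqP; rewrite eq_complex /=; apply/andP; split; apply/eqP; ring.
(* At a corner [rect_boundary] uses the formula of the earlier side, so the two formulas must be
   compared there. *)
- case: ifPn => h1; [|rewrite ifT; last by lra];
    apply/eqP; rewrite eq_complex /=; apply/andP; split; apply/eqP; try ring.
  + have -> : x = 1 / 4 by lra.
    by field.
  + have -> : x = 1 / 4 by lra.
    by field.
- rewrite ifN; last by rewrite -ltNge; lra.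
  case: ifPn => h1; [|rewrite ifT//];
    apply/eqP; rewrite eq_complex /=; apply/andP; split; apply/eqP; try ring.
  + have -> : x = 1 / 2 by lra.
    by field.
  + have -> : x = 1 / 2 by lra.
    by field.
- rewrite ifN; last by rewrite -ltNge; lra.
  rewrite ifN; last by rewrite -ltNge; lra.
  case: ifPn => h1;
    apply/eqP; rewrite eq_complex /=; apply/andP; split; apply/eqP; try ring.
  + have -> : x = 3 / 4 by lra.
    by field.
  + have -> : x = 3 / 4 by lra.
    by field.
Qed.

Definition ext2 (H : itv01 R -> itv01 R -> R[i]) s t : R[i] :=
  oapp (fun y : itv01 R => ext (H y) t) 0 (insub s).

Lemma ext2E H (x y : itv01 R) : ext2 H (val x) (val y) = H x y.
Proof. by rewrite /ext2 valK /= extE. Qed.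

End Presenting.

(** * Properties of the map given by the Cauchy index over a real closed field *)

Section WindingProperties.
Variable R : realFieldType.
Hypothesis rcR : real_closed R.
Variable w : Omega R -> int.
Hypothesis wP : computed_by_cauchy_index w.

Local Notation sg x := ((sgz x)%:~R : rat).

Lemma half_sturmE n (t : nat -> R) (P : nat -> {poly R[i]}) :
  subdivision n t -> half_sturm n t P = half_cauchy_index n t P.
Proof.
move=> [_ _ tlt]; congr (_ * _); apply: eq_bigr => -[k kn] _.
by rewrite (sturmE rcR)// tlt.
Qed.

Lemma winding_sturm : computed_by_sturm w.
Proof. by move=> g n t P pP; rewrite (wP pP) half_sturmE//; case: pP. Qed.

Lemma cindex_cell_horizontal a b u v : a < b -> complex.Im v = 0 ->
  cindex_cell a b (linear_poly u v : {poly R[i]}) = 0.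
Proof.
move=> ab v0; have imE : poly_im (linear_poly u v) = (complex.Im u)%:P.
  by rewrite !poly_reimW /= v0 polyC0 mulr0 mulr0 !addr0.
rewrite /cindex_cell imE; have [->|u0] := eqVneq (complex.Im u) 0.
  by rewrite /idx polyC0 ratfun0r Ind0.
by apply: (idx_noroot rcR) => // x _; rewrite hornerC.
Qed.

Lemma cindex_cell_vertical a b u v : a < b -> complex.Re v = 0 ->
  2 * cindex_cell a b (linear_poly u v : {poly R[i]}) = sg (complex.Re u) *
   (sg (complex.Im u + complex.Im v * b) - sg (complex.Im u + complex.Im v * a)).
Proof.
move=> ab v0; have reE : poly_re (linear_poly u v) = (complex.Re u)%:P.
  by rewrite !poly_reimW /= v0 polyC0 mulr0 mul0r subr0 addr0.
rewrite /cindex_cell reE; have [->|u0] := eqVneq (complex.Re u) 0.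
  by rewrite /idx polyC0 ratfun0l Ind0 sgz0 mul0r mulr0.
rewrite (idx_num_noroot rcR _ ab); last by move=> x _; rewrite hornerC.
by rewrite !hornerC !linear_poly_im !sgzM !intrM mulrBr.
Qed.

Lemma winding_normalization : normalization w.
Proof.
move=> x0 x1 y0 y1 x01 y01 g gE.
have pg : presents g 4 (fun k => k%:R / 4) (rect_poly x0 x1 y0 y1).
  have [tS rP] := rect_presents x0 x1 y0 y1.
  by split=> // k k4 x xk; rewrite gE; exact: rP.
(* Horizontal sides contribute 0 and vertical ones a difference of signs, so one formula in the
   signs of the four bounds settles both claims. *)
have e : (w g)%:~R = 4^-1 * ((sg x1 - sg x0) * (sg y1 - sg y0)).
  rewrite (wP pg) half_cauchy_indexE !big_ord_recr big_ord0 /=.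
  have [_ _ tlt] := rect_subdivision R.
  have e0 := cindex_cell_horizontal (x0 +i* y0) (tlt 0%N isT) (v := 4 * (x1 - x0) +i* 0) erefl.
  have e2 := cindex_cell_horizontal ((x1 - 2 * (x0 - x1)) +i* y1) (tlt 2%N isT) (v := 4 * (x0 - x1) +i* 0) erefl.
  rewrite add0r e0 e2.
  have := cindex_cell_vertical (x1 +i* (y0 - (y1 - y0))) (tlt 1%N isT) (v := 0 +i* (4 * (y1 - y0))) erefl.
  have := cindex_cell_vertical (x0 +i* (y1 - 3 * (y0 - y1))) (tlt 3%N isT) (v := 0 +i* (4 * (y0 - y1))) erefl.
  rewrite /=.
  have -> : y0 - (y1 - y0) + 4 * (y1 - y0) * (2 / 4) = y1 by field.
  have -> : y0 - (y1 - y0) + 4 * (y1 - y0) * (1 / 4) = y0 by field.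
  have -> : y1 - 3 * (y0 - y1) + 4 * (y0 - y1) * (4 / 4) = y0 by field.
  have -> : y1 - 3 * (y0 - y1) + 4 * (y0 - y1) * (3 / 4) = y1 by field.
  move=> e3 e1; apply: (@mulfI _ 4) => //; rewrite mulrA.
  have -> : 4 / 2 = 2 :> rat by field.
  by rewrite add0r addr0 mulrDr e1 e3; field.
split=> [[/andP[h1 h2] /andP[h3 h4]]|nin].
  apply: (@intr_inj rat); rewrite e (ltr0_sgz h1) (gtr0_sgz h2) (ltr0_sgz h3) (gtr0_sgz h4).
  by field.
apply: (@intr_inj rat); rewrite e.
have [x0p|x0n] := ltP 0 x0; first by rewrite (gtr0_sgz x0p) (gtr0_sgz (lt_trans x0p x01)) subrr mul0r mulr0.
have [x1n|x1p] := ltP x1 0; first by rewrite (ltr0_sgz x1n) (ltr0_sgz (lt_trans x01 x1n)) subrr mul0r mulr0.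
have [y0p|y0n] := ltP 0 y0; first by rewrite (gtr0_sgz y0p) (gtr0_sgz (lt_trans y0p y01)) subrr !mulr0.
have [y1n|y1p] := ltP y1 0; first by rewrite (ltr0_sgz y1n) (ltr0_sgz (lt_trans y01 y1n)) subrr !mulr0.
by case: nin; rewrite x0n x1p y0n y1p.
Qed.

Lemma ext_loop_neq0 (g : Omega R) x : 0 <= x <= 1 -> ext g x != 0.
Proof. by move=> x01; rewrite -[x]/(val (mk01 x01)) extE loop_neq0. Qed.

Lemma ext_loop_closed (g : Omega R) : ext g 0 = ext g 1.
Proof. by rewrite -[0]/(val (t0 R)) -[1]/(val (t1 R)) !extE loop_closed. Qed.

Lemma cindex_cell_coprime a b (P : {poly R[i]}) : (forall x, a <= x <= b -> P.[x%:C] != 0) ->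
  coprime_on a b (poly_re P) (poly_im P).
Proof.
by move=> nP x /nP; rewrite horner_reim eq_complex /= => + e; rewrite e eqxx andbT.
Qed.

(** The carry of the product formula depends only on the values of the two loops at a point. It
    telescopes over the cells and cancels because both loops are closed. *)
Lemma winding_multiplicativity : multiplicativity w.
Proof.
move=> g1 g2; apply: (@intr_inj rat).
have [n [t [P [Q [pP pQ]]]]] := common_presentation (loop_piecewise g1) (loop_piecewise g2).
have pPQ : presents (loop_mul g1 g2) n t (fun k => P k * Q k) := presentsM pP pQ.
have [tS _] := pP; have [h0 h1 tlt] := tS.
rewrite intrD (wP pP) (wP pQ) (wP pPQ) !half_cauchy_indexE.
apply: (@mulfI _ 4) => //; rewrite mulrDr !mulrA; have -> : 4 / 2 = 2 :> rat by field.
pose c x : rat := let z1 := ext g1 x in let z2 := ext g2 x in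
  sg (complex.Im z1 * complex.Im z2 * (complex.Re z1 * complex.Im z2 + complex.Re z2 * complex.Im z1)).
have step k : (k < n)%N -> 2 * cindex_cell (t k) (t k.+1) (P k * Q k) =
    2 * cindex_cell (t k) (t k.+1) (P k) + 2 * cindex_cell (t k) (t k.+1) (Q k)
     - (c (t k.+1) - c (t k)).
  move=> kn; rewrite /cindex_cell poly_reM poly_imM.
  have nz (h : Omega R) (S : nat -> {poly R[i]}) : presents h n t S ->
      coprime_on (t k) (t k.+1) (poly_re (S k)) (poly_im (S k)).
    move=> pS; apply: cindex_cell_coprime => x xk; rewrite -(ext_presents pS kn xk).
    exact: ext_loop_neq0 (presents_sub01 tS kn xk).
  rewrite (idx_product rcR (tlt k kn) (nz _ _ pP) (nz _ _ pQ)).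
  have cE x : t k <= x <= t k.+1 -> c x = sg ((poly_im (P k)).[x] * (poly_im (Q k)).[x] *
      (poly_re (P k) * poly_im (Q k) + poly_re (Q k) * poly_im (P k)).[x]).
    by move=> xk; rewrite /c (ext_presents pP kn xk) (ext_presents pQ kn xk) !horner_reim /= hornerD !hornerM.
  by rewrite !cE ?lexx ?(ltW (tlt k kn))//; ring.
rewrite !mulr_sumr (eq_bigr (fun k : 'I_n => 2 * cindex_cell (t k) (t k.+1) (P k) + 2 * cindex_cell (t k) (t k.+1) (Q k)
     - (c (t k.+1) - c (t k)))); last by move=> k _; rewrite step.
rewrite sumrB big_split /= -(big_mkord xpredT (fun k => c (t k.+1) - c (t k))).
rewrite (telescope_sumr (fun k => c (t k)))// h0 h1.
have -> : c 0 = c 1 by rewrite /c !ext_loop_closed.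
by rewrite subrr subr0.
Qed.

Lemma eq_half_cauchy_index n (t : nat -> R) (P Q : nat -> {poly R[i]}) :
  (forall k, (k < n)%N -> P k = Q k) -> half_cauchy_index n t P = half_cauchy_index n t Q.
Proof. by move=> PQ; congr (_ * _); apply: eq_bigr => -[k kn] _; rewrite PQ. Qed.

(** Within a strip of the grid the boundary indices of the cells vanish, and sides shared by
    neighbouring cells cancel, so both ends of the strip have the same index. Neighbouring strips
    agree on their common line. *)
Lemma winding_homotopy : homotopy_invariance w.
Proof.
move=> g0 g1 [H [Hn0 H0 H1 Hc [m [s [n [t [Q [sS tS HQ]]]]]]]].
have [sh0 sh1 slt] := sS; have [th0 th1 tlt] := tS.
case: m sS HQ sh1 slt => [|m] sS HQ sh1 slt.
  by move: sh1; rewrite sh0 => /esym/eqP; rewrite oner_eq0.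
have n0 : (0 < n)%N by rewrite lt0n; apply/eqP => e; move: th1; rewrite e th0 => /esym/eqP; rewrite oner_eq0.
have HE j k x y : (j < m.+1)%N -> (k < n)%N -> s j <= x <= s j.+1 -> t k <= y <= t k.+1 ->
    (Q j k).[x%:C%:P].[y%:C] = ext2 H x y.
  move=> jm kn xj yk; have x01 := presents_sub01 sS jm xj; have y01 := presents_sub01 tS kn yk.
  by rewrite -(HQ j k jm kn (mk01 x01) (mk01 y01))// -ext2E.
have He0 x y : 0 <= x <= 1 -> 0 <= y <= 1 -> ext2 H x y != 0.
  by move=> x01 y01; rewrite -[x]/(val (mk01 x01)) -[y]/(val (mk01 y01)) ext2E.
have [h hE] : exists h : R -> nat -> rat, forall x j,
    h x j = half_cauchy_index n t (fun k => (Q j k).[x%:C%:P]) by eexists.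
have si j : (j < m.+1)%N -> s j <= s j <= s j.+1 by move=> jm; rewrite lexx ltW// slt.
have si' j : (j < m.+1)%N -> s j <= s j.+1 <= s j.+1 by move=> jm; rewrite lexx ltW// slt.
have ti k : (k < n)%N -> t k <= t k <= t k.+1 by move=> kn; rewrite lexx ltW// tlt.
have ti' k : (k < n)%N -> t k <= t k.+1 <= t k.+1 by move=> kn; rewrite lexx ltW// tlt.
have e0 : (w g0)%:~R = h (s 0%N) 0%N.
  rewrite hE; apply: wP; split=> // k kn y yk; rewrite (HE 0%N k _ _ (ltn0Sn m) kn (si 0%N (ltn0Sn m)) yk).
  by rewrite sh0 -H0 -[0]/(val (t0 R)) ext2E.
have e1 : (w g1)%:~R = h (s m.+1) m.
  rewrite hE; apply: wP; split=> // k kn y yk; rewrite (HE m k _ _ (ltnSn m) kn (si' m (ltnSn m)) yk).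
  by rewrite sh1 -H1 -[1]/(val (t1 R)) ext2E.
have glue j : (j.+1 < m.+1)%N -> h (s j.+1) j = h (s j.+1) j.+1.
  move=> jm; rewrite !hE; apply: eq_half_cauchy_index => k kn.
  apply: (eq_poly_itv (tlt k kn)) => y yk.
  rewrite (HE j k _ _ (ltnW jm) kn (si' j (ltnW jm)) yk).
  by rewrite (HE j.+1 k _ _ jm kn (si j.+1 jm) yk).
have strip j : (j < m.+1)%N -> h (s j.+1) j = h (s j) j.
  move=> jm.
  suff S : \sum_(k < n) (cindex_cell (t k) (t k.+1) (Q j k).[(s j.+1)%:C%:P] -
      cindex_cell (t k) (t k.+1) (Q j k).[(s j)%:C%:P]) = 0.
    move/eqP: S; rewrite sumrB subr_eq0 2!hE 2!half_cauchy_indexE => /eqP S.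
    by apply: (congr1 (fun u => 2^-1 * u) S).
  pose U k := poly2_re (Q j k); pose V k := poly2_im (Q j k).
  (* Index along the side [t = t i], computed with the polynomials of cell [k]; by [sideE] it
     depends only on the values of the homotopy. *)
  pose E k i := idx (s j) (s j.+1) (swapXY (U k)).[(t i)%:P] (swapXY (V k)).[(t i)%:P].
  have sideU k i x : (k < n)%N -> t k <= t i <= t k.+1 -> s j <= x <= s j.+1 ->
      (swapXY (U k)).[(t i)%:P].[x] = complex.Re (ext2 H x (t i)) /\
      (swapXY (V k)).[(t i)%:P].[x] = complex.Im (ext2 H x (t i)).
    move=> kn ik xj; rewrite !horner2_swapXY poly2_re_horner poly2_im_horner.
    by rewrite -(HE j k)// horner_reim.
  have sideE k k' i i' : (k < n)%N -> (k' < n)%N -> t k <= t i <= t k.+1 -> t k' <= t i' <= t k'.+1 ->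
      (forall x, s j <= x <= s j.+1 -> ext2 H x (t i) = ext2 H x (t i')) -> E k i = E k' i'.
    move=> kn kn' ik ik' HH; rewrite /E.
    have -> : (swapXY (U k)).[(t i)%:P] = (swapXY (U k')).[(t i')%:P].
      apply: (eq_rpoly_itv (slt j jm)) => x xj.
      by rewrite (sideU k i x kn ik xj).1 (sideU k' i' x kn' ik' xj).1 HH.
    have -> // : (swapXY (V k)).[(t i)%:P] = (swapXY (V k')).[(t i')%:P].
    apply: (eq_rpoly_itv (slt j jm)) => x xj.
    by rewrite (sideU k i x kn ik xj).2 (sideU k' i' x kn' ik' xj).2 HH.
  (* The side at [n] is replaced by the side at 0, on which the homotopy has the same values; the
     telescoping sum thus closes up. *)
  pose G i := if (i < n)%N then E i i else E 0%N 0%N.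
  have cell k : (k < n)%N -> cindex_cell (t k) (t k.+1) (Q j k).[(s j.+1)%:C%:P] -
      cindex_cell (t k) (t k.+1) (Q j k).[(s j)%:C%:P] = G k.+1 - G k.
    move=> kn; have -> : G k = E k k by rewrite /G kn.
    have -> : G k.+1 = E k k.+1.
      rewrite /G; case: ltnP => kSn; first by apply: sideE => //; rewrite ?ti ?ti'.
      have kE : k.+1 = n by apply/eqP; rewrite eqn_leq kSn kn.
      apply: sideE => //; rewrite ?ti ?ti'// => x xj.
      rewrite kE th0 th1; have x01 := presents_sub01 sS jm xj.
      by rewrite -[x]/(val (mk01 x01)) -[0]/(val (t0 R)) -[1]/(val (t1 R)) !ext2E Hc.
    have := @boundary_index0 R rcR (U k) (V k) (s j) (s j.+1) (t k) (t k.+1) (slt j jm) (tlt k kn).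
    rewrite /boundary_index !poly2_re_horner !poly2_im_horner => /(_ _)/eqP.
    rewrite subr_eq0 => H2; apply/eqP/H2 => x y xj yk.
    rewrite poly2_re_horner poly2_im_horner.
    have := He0 x y (presents_sub01 sS jm xj) (presents_sub01 tS kn yk).
    by rewrite -(HE j k)// horner_reim eq_complex /= => + e; rewrite e eqxx andbT.
  rewrite (eq_bigr (fun k : 'I_n => G k.+1 - G k)); last by move=> k _; rewrite cell.
  rewrite -(big_mkord xpredT (fun k => G k.+1 - G k)) (telescope_sumr G)//.
  by rewrite /G ltnn n0 subrr.
have all j : (j < m.+1)%N -> h (s j.+1) j = h (s 0%N) 0%N.
  elim: j => [|j IH] jm; first exact: strip.
  by rewrite (strip j.+1 jm) -(glue j jm) IH// ltnW.
apply: (@intr_inj rat); by rewrite e0 e1 all.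
Qed.

End WindingProperties.

Lemma winding_exists (R : realFieldType) : real_closed R ->
  exists w : Omega R -> int, computed_by_cauchy_index w.
Proof.
move=> rcR.
have [w wP] := choice (half_cauchy_index_int rcR).
by exists w => g n t P pP; rewrite (wP g n t P pP).
Qed.

Lemma winding_unique (R : realFieldType) (w w' : Omega R -> int) :
  computed_by_cauchy_index w -> computed_by_cauchy_index w' -> w = w'.
Proof.
move=> wP wP'; apply: funext => g; have [n [t [P pP]]] := loop_piecewise g.
by apply: (@intr_inj rat); rewrite (wP _ _ _ _ pP) (wP' _ _ _ _ pP).
Qed.

(** * Homotopies between loops *)

Section Loops.
Variable R : realFieldType.
Implicit Types (c z : R[i]) (g : Omega R).

Lemma Re_realM (x : R) z : complex.Re (x%:C * z) = x * complex.Re z.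
Proof. by case: z => a b /=; rewrite mul0r subr0. Qed.
Lemma Im_realM (x : R) z : complex.Im (x%:C * z) = x * complex.Im z.
Proof. by case: z => a b /=; rewrite mul0r addr0. Qed.

Lemma subdivision1 : subdivision 1 (fun k => k%:R : R).
Proof. by split=> // k _; rewrite ltr_nat. Qed.

Definition const_loop c (c0 : c != 0) : Omega R.
Proof.
apply: (@MkOmega _ (fun=> c)) => //; exists 1%N, (fun k => k%:R), (fun=> c%:P).
by split=> [|k _ x _]; [exact: subdivision1|rewrite hornerC].
Defined.

Definition square_loop : Omega R.
Proof.
apply: (@MkOmega _ (rect_boundary (-1) 1 (-1) 1)).
- by exists 4%N, (fun k => k%:R / 4), (rect_poly (-1) 1 (-1) 1); exact: rect_presents.
- rewrite /rect_boundary /= mulr0 mul0r addr0.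
  rewrite ifT; last by lra.
  do 3 (rewrite ifN; last by rewrite -ltNge; lra).
  apply/eqP; rewrite eq_complex /= eqxx /=; apply/eqP; ring.
- move=> [x x01]; rewrite /rect_boundary /= eq_complex /= negb_and.
  have n1 : (1 : R) != 0 := oner_neq0 _; have n2 : (-1 : R) != 0 by rewrite oppr_eq0.
  by do 3 (case: ifP => _; first by rewrite ?n1 ?n2 ?orbT); rewrite n2.
Defined.

Lemma conj_piecewise g : piecewise_poly (fun x => conjc (g x)).
Proof.
have [n [t [P [tS gP]]]] := loop_piecewise g.
exists n, t, (fun k => complex_poly (poly_re (P k)) (- poly_im (P k))); split=> // k kn x xk.
rewrite (gP k kn x xk) horner_reim [RHS]horner_reim poly_re_complex poly_im_complex.
by rewrite hornerN.
Qed.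

Lemma conj_neq0 g x : conjc (g x) != 0.
Proof.
by have := loop_neq0 g x; rewrite !eq_complex; case: (g x) => a b /=; rewrite oppr_eq0.
Qed.

Definition conj_loop g : Omega R :=
  MkOmega (conj_piecewise g) (congr1 conjc (loop_closed g)) (conj_neq0 g).

Fixpoint loop_exp g n : Omega R :=
  if n is m.+1 then loop_mul g (loop_exp g m) else const_loop (oner_neq0 _).

Lemma loop_expE g n x : loop_exp g n x = g x ^+ n.
Proof. by elim: n => [|n IH] //=; rewrite IH exprS. Qed.

Lemma homotopic_linear (g0 g1 : Omega R) :
  (forall x (s : R), 0 <= s <= 1 -> (1 - s)%:C * g0 x + s%:C * g1 x != 0) ->
  homotopic g0 g1.
Proof.
move=> nz; exists (fun s x => (1 - val s)%:C * g0 x + (val s)%:C * g1 x); split.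
- by move=> [s s01] x; apply: nz.
- by move=> x /=; rewrite subr0 mul1r mul0r addr0.
- by move=> x /=; rewrite subrr mul1r mul0r add0r.
- by move=> s; rewrite !loop_closed.
have [n [t [P [Q [[tS gP] [_ hQ]]]]]] := common_presentation (loop_piecewise g0) (loop_piecewise g1).
exists 1%N, (fun k => k%:R), n, t, (fun _ k => (P k)%:P + 'X * (Q k - P k)%:P).
split=> //; first exact: subdivision1.
move=> j k _ kn x y _ yk; rewrite !hornerE /= (gP k kn y yk) (hQ k kn y yk).
by rewrite rmorphB /=; ring.
Qed.

(* The homotopy deforms the homogenization of P from its value at (1, 0) to its
   leading term at (0, g), along (1 - s, s g). *)
Lemma homotopic_homogenization (P : {poly R[i]}) g (P0 : P.[0] != 0) (l0 : lead_coef P != 0) :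
  (forall z, P.[z] != 0) ->
  homotopic (const_loop P0) (loop_mul (const_loop l0) (loop_exp g (size P).-1)).
Proof.
move=> nP; set n := (size P).-1; have Pn0 : P != 0 by rewrite -lead_coef_eq0.
have sP : size P = n.+1 by rewrite prednK// size_poly_gt0.
exists (fun s x => \sum_(i < n.+1) P`_i * (1 - val s)%:C ^+ (n - i) * ((val s)%:C * g x) ^+ i); split.
- move=> [s s01] x /=; have [->|s1] := eqVneq s 1.
    rewrite subrr mul1r big_ord_recr /= big1 ?add0r => [|i _].
      by rewrite subnn expr0 mulr1 mulf_neq0 ?expf_neq0 ?loop_neq0.
    by rewrite expr0n subn_eq0 leqNgt ltn_ord mulr0 mul0r.
  have s2 : (1 - s)%:C != 0 :> R[i] by rewrite eq_complex /= eqxx andbT subr_eq0 eq_sym.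
  (* For [s != 1] the homogeneous form is a nonzero multiple of a value of [P]; at [s = 1], treated
     above, only the leading term remains. *)
  have -> : \sum_(i < n.+1) P`_i * (1 - s)%:C ^+ (n - i) * (s%:C * g x) ^+ i =
      (1 - s)%:C ^+ n * P.[s%:C * g x / (1 - s)%:C].
    rewrite horner_coef sP mulr_sumr; apply: eq_bigr => -[i /= ilt] _.
    rewrite expr_div_n mulrCA -mulrA; congr (_ * _).
    by rewrite [in RHS]mulrCA mulrC -expfB_cond ?(negPf s2)// ?add0n -?ltnS.
  by rewrite mulf_neq0 ?expf_neq0.
- move=> x /=; rewrite big_ord_recl big1 ?addr0 => [|i _]; last by rewrite mul0r expr0n mulr0.
  by rewrite /= expr0 subr0 expr1n !mulr1 horner_coef0.
- move=> x /=; rewrite subrr big_ord_recr /= big1 ?add0r => [|i _]; last first.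
    by rewrite expr0n subn_eq0 leqNgt ltn_ord mulr0 mul0r.
  by rewrite subnn expr0 mulr1 mul1r loop_expE lead_coefE.
- by move=> s; apply: eq_bigr => i _; rewrite loop_closed.
have [m [t [Q [tS gQ]]]] := loop_piecewise g.
exists 1%N, (fun k => k%:R), m, t,
  (fun _ k => \sum_(i < n.+1) (P`_i)%:P%:P * (1 - 'X) ^+ (n - i) * ('X * (Q k)%:P) ^+ i).
split=> //; first exact: subdivision1.
move=> j k _ kn x y _ yk; rewrite !horner_sum; apply: eq_bigr => i _.
rewrite !(hornerE, horner_exp) /= -gQ//.
by rewrite rmorphB.
Qed.

Definition dot (u v : R[i]) : R := complex.Re u * complex.Re v + complex.Im u * complex.Im v.

Lemma dot_convex (u v e : R[i]) (s : R) : 0 <= s <= 1 -> 0 < dot u e -> 0 < dot v e ->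
  0 < dot ((1 - s)%:C * u + s%:C * v) e.
Proof.
move=> /andP[s0 s1] hu hv; rewrite /dot !Re_add !Im_add !Re_realM !Im_realM.
have -> : ((1 - s) * complex.Re u + s * complex.Re v) * complex.Re e +
  ((1 - s) * complex.Im u + s * complex.Im v) * complex.Im e = (1 - s) * dot u e + s * dot v e.
  by rewrite /dot; ring.
move: s0; rewrite le_eqVlt => /predU1P[<-|s0]; first by rewrite subr0 mul1r mul0r addr0.
by rewrite ltr_wpDl ?mulr_ge0 ?subr_ge0 ?(ltW hu)// mulr_gt0.
Qed.

Lemma dot_neq0 u e : 0 < dot u e -> u != 0.
Proof. by apply: contraTneq => ->; rewrite /dot /= !mul0r addr0 ltxx. Qed.

Lemma subdivision_cover n (t : nat -> R) x : subdivision n t -> 0 <= x <= 1 ->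
  exists2 k, (k < n)%N & t k <= x <= t k.+1.
Proof.
move=> [h0 h1 tlt] /andP[x0 x1].
have ex : exists k, (k <= n)%N && (x <= t k) by exists n; rewrite leqnn h1.
case: (ex_minnP ex) => -[|k] /andP[kn xk] kmin.
  exists 0%N; first by rewrite lt0n; apply/eqP => n0; move: h1; rewrite n0 h0 => /esym/eqP; rewrite oner_eq0.
  rewrite h0 x0 (le_trans xk)// ltW// tlt//.
  by rewrite lt0n; apply/eqP => n0; move: h1; rewrite n0 h0 => /esym/eqP; rewrite oner_eq0.
exists k => //; rewrite xk andbT leNgt; apply/negP => xk'.
by have := kmin k; rewrite (ltnW kn) (ltW xk') ltnn => /(_ isT).
Qed.

(** On each cell both loops lie in an open half plane, which is convex and misses 0, so the linear
    homotopy stays in [C^*]. *)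
Lemma homotopic_directions (g0 g1 : Omega R) n (t : nat -> R) (e : nat -> R[i]) :
  subdivision n t ->
  (forall k, (k < n)%N -> forall x, t k <= x <= t k.+1 ->
    0 < dot (ext g0 x) (e k) /\ 0 < dot (ext g1 x) (e k)) ->
  homotopic g0 g1.
Proof.
move=> tS H; apply: homotopic_linear => y s s01.
have [k kn xk] := subdivision_cover tS (valP y).
have [h0 h1] := H k kn _ xk; rewrite !extE in h0 h1.
exact: dot_neq0 (dot_convex s01 h0 h1).
Qed.

(** The loop with straight edges between consecutive [v k]. By convexity an edge stays in every open
    half plane that contains its two ends; the directions [e k] ensure that it avoids 0. *)
Lemma polygon n (t : nat -> R) (v e : nat -> R[i]) : subdivision n t -> v 0%N = v n ->
  (forall k, (k < n)%N -> 0 < dot (v k) (e k) /\ 0 < dot (v k.+1) (e k)) ->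
  exists L : Omega R, forall k, (k < n)%N -> forall f, 0 < dot (v k) f -> 0 < dot (v k.+1) f ->
    forall x, t k <= x <= t k.+1 -> 0 < dot (ext L x) f.
Proof.
move=> tS v0n he; have [h0 h1 tlt] := tS.
case: n tS v0n he h1 tlt => [|n] tS v0n he h1 tlt.
  by move: h1; rewrite h0 => /esym/eqP; rewrite oner_eq0.
(* [ramp i] rises linearly from 0 to 1 on cell [i], so a single formula adds up the edges already
   travelled and a fraction of the current one. *)
pose ramp i x : R := if x <= t i then 0 else if t i.+1 <= x then 1
  else (x - t i) / (t i.+1 - t i).
pose L (y : itv01 R) : R[i] := v 0%N + \sum_(i < n.+1) (ramp i (val y))%:C * (v i.+1 - v i).
pose lam k x := (x - t k) / (t k.+1 - t k).
have LE k (y : itv01 R) : (k < n.+1)%N -> t k <= val y <= t k.+1 ->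
    L y = (1 - lam k (val y))%:C * v k + (lam k (val y))%:C * v k.+1.
  move=> kn /andP[ky yk]; rewrite /L; move: (val y) ky yk => x kx xk.
  have -> : \sum_(i < n.+1) (ramp i x)%:C * (v i.+1 - v i) =
     \sum_(0 <= i < k) (v i.+1 - v i) + (lam k x)%:C * (v k.+1 - v k).
    rewrite -(big_mkord xpredT (fun i => (ramp i x)%:C * (v i.+1 - v i))).
    rewrite (@big_cat_nat _ _ _ k 0 n.+1 _ _ (leq0n k) (ltnW kn)) (@big_cat_nat _ _ _ k.+1 k n.+1 _ _ (leqnSn k) kn) /=.
    rewrite big_nat1 [X in _ + (_ + X)]big_nat_cond [X in _ + (_ + X)]big1 ?addr0; last first.
      move=> i /andP[/andP[ki i_n] _]; rewrite /ramp ifT ?mul0r//.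
      by rewrite (le_trans xk)// (subdivision_le tS)// ki ltnW.
    congr (_ + _ * _).
      apply: eq_big_nat => i /andP[_ ik]; rewrite /ramp.
      have tik : t i.+1 <= x by rewrite (le_trans _ kx)// (subdivision_le tS)// ik ltnW.
      have tii : t i < t i.+1 by rewrite tlt// (ltn_trans ik).
      by rewrite ifF ?tik ?mul1r//; apply/negbTE; rewrite -ltNge (lt_le_trans tii).
    rewrite /ramp /lam; have tk := tlt k kn; congr (_%:C).
    case: ifP => h.
      have -> : x = t k by apply/eqP; rewrite eq_le h kx.
      by rewrite subrr mul0r.
    case: ifP => // h2; have -> : x = t k.+1 by apply/eqP; rewrite eq_le h2 xk.
    by rewrite divff// subr_eq0 gt_eqF.
  rewrite telescope_sumr//= rmorphB /=; ring.
have lam01 k x : (k < n.+1)%N -> t k <= x <= t k.+1 -> 0 <= lam k x <= 1.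
  move=> kn /andP[kx xk]; have tk : 0 < t k.+1 - t k by rewrite subr_gt0 tlt.
  by rewrite /lam divr_ge0 ?subr_ge0 ?(ltW (tlt _ kn))//= ler_pdivrMr// mul1r lerD2r.
have Lf k f (y : itv01 R) : (k < n.+1)%N -> 0 < dot (v k) f -> 0 < dot (v k.+1) f ->
    t k <= val y <= t k.+1 -> 0 < dot (L y) f.
  by move=> kn h2 h3 yk; rewrite (LE k)//; apply: dot_convex => //; apply: lam01.
have Lp : piecewise_poly L.
  exists n.+1, t, (fun k => linear_poly (v k - (t k / (t k.+1 - t k))%:C * (v k.+1 - v k))
      ((t k.+1 - t k)^-1%:C * (v k.+1 - v k))); split=> // k kn y yk.
  rewrite (LE k)// /linear_poly !hornerE /lam /= mulrBl rmorphB rmorphD /= !rmorphB !rmorphM /=; ring.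
have L01 : L (t0 R) = L (t1 R).
  rewrite (LE n (t1 R)) ?ltnSn//; last by rewrite /= -h1 lexx ltW// tlt.
  rewrite (LE 0%N (t0 R))//; last by rewrite /= -h0 lexx ltW// tlt.
  rewrite /lam /= h0 subrr mul0r h1 divff; last first.
    by rewrite subr_eq0 gt_eqF// -h1 tlt.
  by rewrite !subr0 subrr v0n !rmorph1 !rmorph0 !mul0r addr0 add0r.
have Ln0 y : L y != 0.
  have [k kn yk] := subdivision_cover tS (valP y); have [h2 h3] := he k kn.
  exact: dot_neq0 (Lf k _ y kn h2 h3 yk).
exists (MkOmega Lp L01 Ln0) => k kn f h2 h3 x xk.
have x01 := presents_sub01 tS kn xk.
by rewrite -[x]/(val (mk01 x01)) extE; apply: (Lf k).
Qed.

End Loops.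

(** * The converse *)

(** The remainder modulo the real quadratic is at most linear with real coefficients and vanishes at
    a non-real point, hence is 0. *)
Lemma root_im_quadratic (R : realFieldType) (p : {poly R}) (u v : R) : v != 0 ->
  root (map_poly (real_complex R) p) (u +i* v) ->
  exists q, p = q * (('X - u%:P) ^+ 2 + (v ^+ 2)%:P).
Proof.
move=> v0 rz; set m := _ + _.
have mE : m = 'X ^+ 2 + (- (u *+ 2) *: 'X + (u ^+ 2 + v ^+ 2)%:P).
  rewrite /m sqrrB -mul_polyC !rmorphD rmorphN rmorphMn !rmorphXn /=; ring.
have ms : size m = 3%N.
  rewrite mE size_polyDl size_polyXn// (leq_ltn_trans (size_polyD _ _))//.
  rewrite gtn_max (leq_ltn_trans (size_scale_leq _ _)) ?size_polyX//=.
  by rewrite (leq_ltn_trans (size_polyC_leq1 _)).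
have m0 : m != 0 by rewrite -size_poly_eq0 ms.
exists (p %/ m); rewrite {1}(divp_eq p m); set r := p %% m.
suff -> : r = 0 by rewrite addr0.
have sr : (size r <= 2)%N by rewrite -ltnS -ms ltn_modp.
pose f : {rmorphism R -> R[i]} := real_complex R.
have rr : (map_poly f r).[u +i* v] = 0.
  move/eqP: rz; rewrite {1}(divp_eq p m) rmorphD rmorphM /= hornerD hornerM.
  have -> : (map_poly (real_complex R) m).[u +i* v] = 0; last by rewrite mulr0 add0r.
  rewrite /m rmorphD rmorphXn rmorphB /= map_polyX !map_polyC /=.
  rewrite hornerD horner_exp hornerXsubC hornerC.
  by apply/eqP; rewrite eq_complex expr2 /=; apply/andP; split; apply/eqP; ring.
have rE : r = (r`_0)%:P + r`_1 *: 'X.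
  apply/polyP => -[|[|i]]; rewrite !coefE ?mulr1 ?mulr0 ?addr0 ?add0r//.
  by rewrite nth_default// (leq_trans sr).
have e1 : r`_1 = 0.
  move: rr; rewrite {1}rE rmorphD /= map_polyC map_polyZ map_polyX /= !hornerE /=.
  move/eqP; rewrite eq_complex /= => /andP[_]; rewrite mul0r add0r addr0.
  by rewrite mulf_eq0 (negPf v0) orbF => /eqP.
have e0 : r`_0 = 0.
  move: rr; rewrite {1}rE e1 scale0r addr0 map_polyC hornerC.
  by move/eqP; rewrite eq_complex /= => /andP[/eqP].
by rewrite rE e0 e1 scale0r addr0.
Qed.

Lemma alg_closed_real_closed (R : realFieldType) :
  (forall P : {poly R[i]}, (1 < size P)%N -> exists z, root P z) -> real_closed R.
Proof.
move=> ac p a b ab; move: (leqnn (size p)); move: {2}(size p) => n.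
elim: n p => [|n IH] p sp pab.
  by move: sp pab; rewrite size_poly_leq0 => /eqP->; rewrite !horner0 mulr0 ltxx.
have p0 : p != 0 by apply: contraTneq pab => ->; rewrite !horner0 mulr0 ltxx.
have [|[u v] rz] := ac (map_poly (real_complex R) p).
  rewrite size_map_poly ltnNge; apply: contraTN pab => /size1_polyC->.
  by rewrite !hornerC -leNgt -expr2 sqr_ge0.
(* A factor with equal signs at [a] and [b] can be removed without losing the sign change: a linear
   one with root outside the interval, or a quadratic without real root. *)
have step q m : p = q * m -> 0 < m.[a] * m.[b] -> (1 < size m)%N ->
    exists2 x, a < x < b & p.[x] = 0.
  move=> pE mab sm; have q0 : q != 0 by apply: contraNneq p0; rewrite pE => ->; rewrite mul0r.
  have m0 : m != 0 by rewrite -size_poly_gt0 ltnW.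
  have [||x xab qx] := IH q.
  - rewrite -ltnS (leq_trans _ sp)// pE size_mul//.
    rewrite -(prednK (ltnW sm)) addnS /= -[X in (X < _)%N]addn0 ltn_add2l.
    by move: sm; case: (size m) => [|[|]].
  - move: pab; rewrite pE !hornerM mulrACA pmulr_llt0//.
  by exists x => //; rewrite pE hornerM qx mul0r.
have [v0|v0] := eqVneq v 0.
  have ru : p.[u] = 0.
    move/eqP: rz; rewrite v0 -[u +i* 0]/(u%:C) horner_map /=.
    by move/eqP; rewrite eq_complex /= => /andP[/eqP].
  have [/andP[au ub]|nu] := boolP (a < u < b); first by exists u; rewrite ?au.
  have /factor_theorem[q pE] : root p u by apply/eqP.
  apply: (step q _ pE); last by rewrite size_XsubC.
  have ua : u != a by apply: contraTneq pab => <-; rewrite ru mul0r ltxx.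
  have ub : u != b by apply: contraTneq pab => <-; rewrite ru mulr0 ltxx.
  rewrite !hornerXsubC; move: nu; rewrite negb_and -!leNgt => /orP[ua'|bu'].
    have h : u < a by rewrite lt_neqAle ua.
    by rewrite mulr_gt0 ?subr_gt0// (lt_trans h).
  have h : b < u by rewrite lt_neqAle eq_sym ub.
  by rewrite nmulr_rgt0 subr_lt0// (lt_trans ab).
have [q pE] := root_im_quadratic v0 rz.
have pos x : 0 < (('X - u%:P) ^+ 2 + (v ^+ 2)%:P).[x].
  rewrite hornerD horner_exp hornerXsubC hornerC ltr_wpDl ?sqr_ge0//.
  by rewrite lt_def sqr_ge0 expf_eq0 v0.
apply: (step q _ pE); first exact: mulr_gt0.
rewrite size_polyDl ?size_exp_XsubC//.
by rewrite (leq_ltn_trans (size_polyC_leq1 _)).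
Qed.

(** * Consequences of normalization, multiplicativity and homotopy invariance *)

Section Converse.
Variable R : realFieldType.
Variable w : Omega R -> int.
Hypothesis w1 : normalization w.
Hypothesis w2 : multiplicativity w.
Hypothesis w3 : homotopy_invariance w.
Implicit Types (c z : R[i]) (g : Omega R).

Lemma winding_ext (g0 g1 : Omega R) : g0 =1 g1 -> w g0 = w g1.
Proof.
move=> e; apply/w3/homotopic_linear => x s _.
by rewrite e -mulrDl -rmorphD /= subrK rmorph1 mul1r loop_neq0.
Qed.

Lemma winding_const1 : w (const_loop (oner_neq0 R[i])) = 0.
Proof.
set o := const_loop _; have : w (loop_mul o o) = w o.
  by apply: winding_ext => x /=; rewrite mulr1.
by rewrite w2 => /eqP; rewrite -subr_eq0 addrK => /eqP.
Qed.

(** The complement of the closed negative real half line is star-shaped about 1, so such a loop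
    contracts linearly to 1. *)
Lemma winding_slit g :
  (forall x, complex.Im (g x) != 0 \/ 0 < complex.Re (g x)) -> w g = 0.
Proof.
move=> gs; rewrite -winding_const1; apply/w3/homotopic_linear => x s /andP[s0 s1].
rewrite /= mulr1 eq_complex Re_add Im_add Re_realM Im_realM /= addr0.
have [-> /=|s1'] := eqVneq s 1; first by rewrite subrr mul0r add0r oner_eq0.
have ss : 0 < 1 - s by rewrite subr_gt0 lt_neqAle s1'.
rewrite negb_and; case: (gs x) => h; first by rewrite mulf_neq0 ?orbT// gt_eqF.
by rewrite gt_eqF// ltr_wpDr// mulr_gt0.
Qed.

Lemma winding_const c (c0 : c != 0) : w (const_loop c0) = 0.
Proof.
have [ci|ci] := eqVneq (complex.Im c) 0; last by apply: winding_slit => x; left.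
have cr : complex.Re c != 0 by move: c0; rewrite eq_complex ci eqxx andbT.
(* A real constant may be negative, but its square is positive, and the integers have no
   2-torsion. *)
have : w (loop_mul (const_loop c0) (const_loop c0)) = 0.
  apply: winding_slit => x /=; right; case: (c) ci cr => a b /= -> a0.
  by rewrite mulr0 subr0 -expr2 lt_def sqr_ge0 expf_eq0 a0.
rewrite w2; lia.
Qed.

Lemma winding_square : w (square_loop R) = 1.
Proof.
have n11 : (-1 : R) < 1 by lra.
have [h _] := w1 n11 n11 (gamma := square_loop R) (fun=> erefl).
by apply: h; split; lra.
Qed.

Lemma winding_exp g n : w (loop_exp g n) = w g *+ n.
Proof.
elim: n => [|n IH] /=; first exact: winding_const1.
by rewrite w2 IH mulrS.
Qed.

Lemma winding_alg_closed (P : {poly R[i]}) : (1 < size P)%N -> exists z, root P z.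
Proof.
move=> sP; have [//|nr] := pselect (exists z, root P z).
have nz z : P.[z] != 0 by apply/eqP => Pz; apply: nr; exists z; apply/eqP.
have l0 : lead_coef P != 0 by rewrite lead_coef_eq0 -size_poly_gt0 ltnW.
have /w3 := homotopic_homogenization (square_loop R) (nz 0) l0 nz.
rewrite w2 !winding_const winding_exp winding_square add0r.
by move/esym/eqP; rewrite pnatr_eq0 -subn1 subn_eq0 leqNgt sP.
Qed.

Lemma winding_real_closed : real_closed R.
Proof. exact: alg_closed_real_closed winding_alg_closed. Qed.

(** The product of a loop and its conjugate is the positive real norm, which has winding number
    0. *)
Lemma winding_conj g : w (conj_loop g) = - w g.
Proof.
have : w (loop_mul g (conj_loop g)) = 0.
  apply: winding_slit => x /=; right; have := loop_neq0 g x.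
  case: (g x) => a b; rewrite eq_complex /= negb_and mulrN opprK -!expr2 => /orP[] h.
    by rewrite ltr_wpDr ?sqr_ge0// lt_def sqr_ge0 expf_eq0 h.
  by rewrite ltr_wpDl ?sqr_ge0// lt_def sqr_ge0 expf_eq0 h.
rewrite w2; lia.
Qed.

(** This is ['i ^ k]: the sine of [k] quarter turns is the cosine of [k - 1] of them. *)
Definition dir (k : int) : R[i] := qcos R k +i* qcos R (k - 1).

Lemma halfplaneE k z : halfplane k z = dot z (dir k).
Proof. by []. Qed.

Lemma dot_dir k : dot (dir k) (dir k) = 1.
Proof.
by rewrite /dot /=; have [[-> -> _]|[-> -> _]|[-> -> _]|[-> -> _]] := qcos_cases R k; ring.
Qed.

Lemma dot_dir1 k : dot (dir k) (dir (k - 1)) = 0.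
Proof.
have e : qcos R (k - 1 - 1) = - qcos R k.
  by rewrite -[in RHS](subrK 2 k) qcosD2 opprK; congr qcos; ring.
by rewrite /dot /= e; ring.
Qed.

Lemma dotC (u v : R[i]) : dot u v = dot v u.
Proof. by rewrite /dot; ring. Qed.
Lemma dotDl (u v e : R[i]) : dot (u + v) e = dot u e + dot v e.
Proof. by rewrite /dot Re_add Im_add; ring. Qed.
Lemma dotDr (u v e : R[i]) : dot e (u + v) = dot e u + dot e v.
Proof. by rewrite !(dotC e) dotDl. Qed.

Lemma dot_dir_ge0 k l : `|k - l| <= 1 -> 0 <= dot (dir k) (dir l).
Proof.
move=> kl; have [->|[->|->]] : k = l \/ l = k - 1 \/ k = l - 1 by lia.
- by rewrite dot_dir.
- by rewrite dot_dir1.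
- by rewrite dotC dot_dir1.
Qed.

(* Cutting off the highest level of the lift k, one level at a time, deforms a
   loop with a closed lift to a loop in a half plane. *)
Lemma winding_closed_lift N m n (t : nat -> R) (k : nat -> int) g :
  subdivision n t -> k n = k 0%N ->
  (forall i, (i < n)%N -> `|k i.+1 - k i| <= 1) ->
  (forall i, (i <= n)%N -> m <= k i <= m + N%:Z) ->
  (forall i, (i < n)%N -> forall x, t i <= x <= t i.+1 -> 0 < dot (ext g x) (dir (k i))) ->
  w g = 0.
Proof.
elim: N k g => [|N IH] k g tS kn kk km hg.
  (* Base case: [k] is constantly [m], so [g] stays in one half plane and contracts to [dir m]. *)
  rewrite -(@winding_const (dir m) _); first by rewrite eq_complex negb_and /=;
    have [[-> _ _]|[_ -> _]|[-> _ _]|[_ -> _]] := qcos_cases R m;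
    rewrite ?oppr_eq0 oner_eq0 ?orbT.
  move=> m0; apply/w3/(homotopic_directions (e := fun=> dir m) tS) => i i_n x xi.
  have kim : k i = m by have := km i (ltnW i_n); lia.
  have := hg i i_n x xi; rewrite kim => h; split=> //.
  by rewrite /ext; case: insubP => [y _ _|] /=; rewrite ?dot_dir// (presents_sub01 tS i_n xi).
have n_gt0 : (0 < n)%N.
  have [h0 h1 _] := tS.
  by rewrite lt0n; apply/eqP => n0; move: h1; rewrite n0 h0 => /esym/eqP; rewrite oner_eq0.
(* Cyclic predecessor of a cell. The vertex [v k i] is the sum of the directions of the two cells
   that meet at [t i], so it lies in both of their half planes. *)
pose prev i := if i is j.+1 then j else n.-1.
pose v (k : nat -> int) i := dir (k (prev i)) + dir (k i).
have poly (l : nat -> int) : l n = l 0%N -> (forall i, (i < n)%N -> `|l i.+1 - l i| <= 1) ->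
    [/\ forall i, (i < n)%N -> `|l (prev i) - l i| <= 1,
      forall i, (i < n)%N -> 0 < dot (v l i) (dir (l i)) /\ 0 < dot (v l i.+1) (dir (l i)) &
      v l 0%N = v l n].
  move=> ln ll.
  have lp i : (i < n)%N -> `|l (prev i) - l i| <= 1.
    case: i => [|i] i_n /=; last by rewrite distrC ll// ltnW.
    by rewrite -ln distrC -{1}(prednK n_gt0) ll// prednK.
  split=> //.
    move=> i i_n; rewrite /v !dotDl dot_dir; split.
      by rewrite ltr_wpDl// dot_dir_ge0// lp.
    by rewrite ltr_wpDr// dot_dir_ge0// ll.
  by rewrite /v ln /prev; case: (n) n_gt0.
(* Only the top level [m + N + 1] is lowered, by one step; steps stay at most 1 and the lift stays
   closed. *)
pose k' i := Num.min (k i) (m + N%:Z).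
have k'n : k' n = k' 0%N by rewrite /k' kn.
have k'k i : (i < n)%N -> `|k' i.+1 - k' i| <= 1.
  by move=> /kk; rewrite /k'; lia.
have [kp kv kv0] := poly k kn kk; have [k'p k'v k'v0] := poly k' k'n k'k.
have [L LP] := polygon tS kv0 kv; have [L' LP'] := polygon tS k'v0 k'v.
have gL : w g = w L.
  apply/w3/(homotopic_directions (e := fun i => dir (k i)) tS) => i i_n x xi.
  by have [h1 h2] := kv i i_n; split; [exact: hg|exact: (LP i i_n _ h1 h2 x xi)].
have L'0 : w L' = 0.
  apply: (IH k') => // [i i_n|i i_n x xi].
    by have := km i i_n; rewrite /k'; lia.
  by have [h1 h2] := k'v i i_n; exact: (LP' i i_n _ h1 h2 x xi).
rewrite gL -L'0.
(* On a lowered cell the old and the new polygon share the half plane of the diagonal between the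
   two directions: levels next to the top one are at most one step below it. *)
pose e i := if k i <= m + N%:Z then dir (k i) else dir (k i) + dir (k i - 1).
apply/w3/(homotopic_directions (e := e) tS) => i i_n x xi.
have [h1 h2] := kv i i_n; have [h3 h4] := k'v i i_n.
rewrite /e; case: ifPn => [kle|kgt].
  have kE : k' i = k i by rewrite /k'; lia.
  by rewrite kE in h3 h4; split; [exact: (LP i i_n _ h1 h2 x xi)|exact: (LP' i i_n _ h3 h4 x xi)].
have kiE : k i = m + N%:Z + 1 by have := km i (ltnW i_n); lia.
have k'iE : k' i = k i - 1 by rewrite /k'; lia.
have top a : a <= k i -> `|a - k i| <= 1 -> 0 < dot (dir a) (dir (k i) + dir (k i - 1)).
  move=> ak akd; have [->|->] : a = k i \/ a = k i - 1 by lia.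
    by rewrite dotDr dot_dir dot_dir1 addr0.
  by rewrite dotDr dot_dir dotC dot_dir1 add0r.
have top' : 0 < dot (dir (k i - 1)) (dir (k i) + dir (k i - 1)) by apply: top; lia.
have topk : 0 < dot (dir (k i)) (dir (k i) + dir (k i - 1)) by apply: top; lia.
have pn : (prev i <= n)%N by case: (i) i_n => [_|j /ltnW/ltnW] //=; exact: leq_pred.
split.
  apply: (LP i i_n _ _ _ x xi); rewrite /v dotDl addr_gt0//.
    by apply: top; [have := km _ pn; lia|exact: kp].
  by rewrite /= ; apply: top; [have := km _ i_n; lia|exact: kk].
apply: (LP' i i_n _ _ _ x xi); rewrite /v dotDl k'iE addr_gt0//.
  have -> // : k' (prev i) = k i - 1.
  by have := kp i i_n; have := km _ pn; rewrite /k'; lia.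
have -> // : k' i.+1 = k i - 1.
by have := kk i i_n; have := km _ i_n; rewrite /k'; lia.
Qed.

Section Comparison.
Variable omega : Omega R -> int.
Hypothesis omegaP : computed_by_cauchy_index omega.

Lemma winding_index0 g : omega g = 0 -> w g = 0.
Proof.
move=> g0; have rcR := winding_real_closed.
have [n [t [P [k [K [pP hP kk kn]]]]]] := sector_lift rcR g.
have K0 : K = 0.
  apply: (@intr_inj rat); rewrite -(half_cauchy_index_lift rcR pP hP kk kn).
  by rewrite -(omegaP pP) g0.
have [tS _] := pP.
have kb i : (i <= n)%N -> `|k i - k 0%N| <= i%:Z.
  elim: i => [|i IH] i_n; first by rewrite subrr.
  by have := IH (ltnW i_n); have := kk i i_n; lia.
(* The [n] unit steps keep the lift within [n] of its start, hence [2 * n] levels above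
   [k 0%N - n%:Z]. *)
apply: (@winding_closed_lift (2 * n) (k 0%N - n%:Z) n t k g) => //.
- by rewrite kn K0 mul0r addr0.
- by move=> i i_n; have := kb i i_n; lia.
- by move=> i i_n x xi; rewrite (ext_presents pP i_n xi) -halfplaneE; apply: hP.
Qed.

End Comparison.
End Converse.

(** * Agreement of any such map with the index *)

Section Uniqueness.
Variable R : realFieldType.
Variables (w omega : Omega R -> int).
Hypothesis w1 : normalization w.
Hypothesis w2 : multiplicativity w.
Hypothesis w3 : homotopy_invariance w.
Hypothesis omegaP : computed_by_cauchy_index omega.

Lemma winding_eq (g : Omega R) : w g = omega g.
Proof.
have rcR := winding_real_closed w1 w2 w3.
have o1 := winding_normalization rcR omegaP; have o2 := winding_multiplicativity rcR omegaP.
have o3 := winding_homotopy rcR omegaP.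
(* A loop of index 1 or -1 whose power brings the index of [g] to 0. Both maps agree on this power,
   so vanishing on the product [d] determines [w g]. *)
pose s : Omega R := if omega g <= 0 then square_loop R else conj_loop (square_loop R).
pose d := loop_mul g (loop_exp s `|omega g|%N).
have d0 : omega d = 0.
  rewrite o2 (winding_exp o2 o3) /s; case: ifPn => h.
    by rewrite (winding_square o1); lia.
  by rewrite (winding_conj o2 o3) (winding_square o1); lia.
have := winding_index0 w1 w2 w3 omegaP d0.
rewrite w2 (winding_exp w2 w3) /s; case: ifPn => h.
  by rewrite (winding_square w1); lia.
by rewrite (winding_conj w2 w3) (winding_square w1); lia.
Qed.

End Uniqueness.

Theorem theorem1p2 (R : realFieldType) :
  [/\ forall (gamma : Omega R) n t P n' t' P',
        presents gamma n t P -> presents gamma n' t' P' ->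
        half_cauchy_index n t P = half_cauchy_index n' t' P',
      real_closed R ->
        (exists! w : Omega R -> int, computed_by_cauchy_index w) /\
        (forall w : Omega R -> int, computed_by_cauchy_index w ->
           [/\ computed_by_sturm w, normalization w,
               multiplicativity w & homotopy_invariance w]) &
      forall w : Omega R -> int,
        normalization w -> multiplicativity w -> homotopy_invariance w ->
        [/\ real_closed R, computed_by_cauchy_index w & computed_by_sturm w]].
Proof.
split=> [gamma n t P n' t' P'|rcR|w w1 w2 w3].
- exact: half_cauchy_index_uniq.
- split=> [|w wP].
    have [w wP] := winding_exists rcR.
    by exists w; split=> // w' w'P; exact: winding_unique.
  split; [exact: winding_sturm|exact: winding_normalization|
    exact: winding_multiplicativity|exact: winding_homotopy].
have rcR := winding_real_closed w1 w2 w3.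
have [omega omegaP] := winding_exists rcR.
have wE : w = omega by apply: funext => g; exact: winding_eq.
by rewrite wE; split=> //; exact: winding_sturm.
Qed.
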